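(* Let $A$ be a commutative unital Banach algebra over $\mathbb{K}$, and let $\iota\colon A\to B$ be a norm-decreasing central homomorphism of unital Banach algebras. Then the following conditions are equivalent: (i) $\iota$ is an effective descent morphism for Banach modules; that is, the extension-of-scalars functor $B\,\widehat{\otimes}_A -\colon {}_A\mathsf{Ban}^1\to {}_B\mathsf{Ban}^1$ is comonadic; (ii) $\iota$ is a $\widehat{\otimes}$-pure morphism in ${}_A\mathsf{Ban}^1$; that is, for every Banach $A$-module $V$, the morphism $\iota\,\widehat{\otimes}_A V\colon V = A\,\widehat{\otimes}_A V\to B\,\widehat{\otimes}_A V$ is an isometric inclusion; (iii) $\iota$ is a weak retract in ${}_A\mathsf{Ban}^1$; that is, $\iota^*\colon B^*\to A^*$ is a split epimorphism in ${}_A\mathsf{Ban}^1$.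
   Context: $\mathbb{K}$ is $\mathbb{R}$ or $\mathbb{C}$. $\mathsf{Ban}^1$ is the category whose objects are Banach spaces over $\mathbb{K}$ and whose morphisms are linear contractions (linear maps of norm $\le 1$). It is symmetric monoidal closed under the projective tensor product $\widehat{\otimes}$, with unit object $\mathbb{K}$ and internal hom $[V,W]$ the Banach space of bounded linear maps with the operator norm. Unital Banach algebras are the monoids in $\mathsf{Ban}^1$: the multiplication satisfies $\|ab\|\le\|a\|\|b\|$ and the unit $e$ satisfies $\|e\|\le 1$. A norm-decreasing homomorphism of unital Banach algebras is a morphism of such monoids, i.e. a unital algebra homomorphism $\iota$ with $\|\iota(a)\|\le\|a\|$. It is central if $\iota(a)b=b\,\iota(a)$ for all $a\in A$, $b\in B$. For a unital Banach algebra $A$, ${}_A\mathsf{Ban}^1$ is the category of (left) Banach $A$-modules: Banach spaces $V$ with a unital associative bilinear action satisfying $\|av\|\le\|a\|\|v\|$; morphisms are the $A$-linear contractions. $B$ is an $A$-module via $\iota$. $B\,\widehat{\otimes}_A V$ is the coequalizer in $\mathsf{Ban}^1$ of the two maps $B\,\widehat{\otimes}\,A\,\widehat{\otimes}\,V\rightrightarrows B\,\widehat{\otimes}\,V$ given by $b\otimes a\otimes v\mapsto b\,\iota(a)\otimes v$ and $b\otimes a\otimes v\mapsto b\otimes av$ (the quotient of $B\,\widehat{\otimes}\,V$ by the closed linear span of the elements $b\,\iota(a)\otimes v-b\otimes av$, with the quotient norm), and it is a left $B$-module by multiplication on the first factor. Under the identification $V=A\,\widehat{\otimes}_A V$, the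 map $\iota\,\widehat{\otimes}_A V$ sends $v$ to the class of $e_B\otimes v$. The functor $B\,\widehat{\otimes}_A-$ is left adjoint to the restriction-of-scalars functor ${}_B\mathsf{Ban}^1\to{}_A\mathsf{Ban}^1$. A functor with a right adjoint is comonadic if its canonical comparison functor, from its domain to the category of (Eilenberg–Moore) coalgebras over the comonad that the adjunction induces on its codomain, is an equivalence of categories. For commutative $A$ and an $A$-module $V$, the dual $V^*=[V,\mathbb{K}]$ is an $A$-module via $(af)(v)=f(av)$, and for a morphism $f\colon V\to W$ in ${}_A\mathsf{Ban}^1$ the dual map $f^*\colon W^*\to V^*$ is a morphism in ${}_A\mathsf{Ban}^1$. The morphism $f$ is a weak retract in ${}_A\mathsf{Ban}^1$ if $f^*$ is a split epimorphism in ${}_A\mathsf{Ban}^1$, i.e. there is an $A$-linear contraction $s\colon V^*\to W^*$ with $f^*s=\mathrm{id}_{V^*}$. An isometric inclusion is a norm-preserving linear map. *)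

(* Defs.v *)
From HB Require Import structures.
From mathcomp Require Import all_boot all_order all_algebra.
From mathcomp Require Import all_classical.
From mathcomp Require Import reals interval_inference topology normedtype.
From mathcomp Require Import complex freeg lra.
Set Implicit Arguments.
Unset Strict Implicit.
Unset Printing Implicit Defensive.
Import Order.TTheory GRing.Theory Num.Theory.
Import numFieldNormedType.Exports.
Local Open Scope classical_set_scope.
Local Open Scope ring_scope.

Variant scalar_kind := RealScalars | ComplexScalars.

Definition scalars (R : realType) (k : scalar_kind) : numFieldType :=
  match k with RealScalars => R | ComplexScalars => R[i] end.

(* Norms in MathComp-Analysis take their values in the scalar field itself.
   Infima are computed in R, and moved to the scalar field with [toK]. *)
Definition toK (R : realType) (k : scalar_kind) : R -> scalars R k :=
  match k with
  | RealScalars => fun r => r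
  | ComplexScalars => fun r => Complex r 0
  end.

Definition reK (R : realType) (k : scalar_kind) : scalars R k -> R :=
  match k with
  | RealScalars => fun x => x
  | ComplexScalars => @complex.Re R
  end.

Section Scalars.
Context (R : realType) (k : scalar_kind).
Local Notation K := (scalars R k).
Local Notation toK := (@toK R k).
Implicit Types (r s : R).

Lemma toKK r : reK (toK r) = r. Proof. by rewrite /toK /reK; case: k. Qed.

Lemma reKK (x : K) : 0 <= x -> toK (reK x) = x.
Proof.
rewrite /toK /reK; case: k x => //= -[a b]; rewrite lecE /=.
by case/andP => /eqP ->.
Qed.

Lemma ler_toK r s : (toK r <= toK s) = (r <= s).
Proof. by rewrite /toK; case: k => //; rewrite lecE /= eqxx. Qed.

Lemma ltr_toK r s : (toK r < toK s) = (r < s).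
Proof. by rewrite /toK; case: k => //; rewrite ltcE /= eqxx. Qed.

Lemma toK0 : toK 0 = 0. Proof. by rewrite /toK; case: k. Qed.

Lemma toK1 : toK 1 = 1. Proof. by rewrite /toK; case: k. Qed.

Lemma toKD r s : toK (r + s) = toK r + toK s.
Proof.
by rewrite /toK; case: k => //; apply/eqP; rewrite eq_complex /= addr0 !eqxx.
Qed.

Lemma toKM r s : toK (r * s) = toK r * toK s.
Proof.
rewrite /toK; case: k => //; apply/eqP; rewrite eq_complex /=.
by rewrite !mulr0 mul0r subr0 addr0 !eqxx.
Qed.

Definition nrm (V : normedZmodType K) (x : V) : R := reK `|x|.

Section Nrm.
Variable V : normedZmodType K.
Implicit Types x y : V.

Lemma toK_nrm x : toK (nrm x) = `|x|. Proof. by rewrite reKK. Qed.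
Lemma nrm_ge0 x : 0 <= nrm x. Proof. by rewrite -ler_toK toK_nrm toK0. Qed.
Lemma nrmD x y : nrm (x + y) <= nrm x + nrm y.
Proof. by rewrite -ler_toK toKD !toK_nrm ler_normD. Qed.
Lemma nrmN x : nrm (- x) = nrm x. Proof. by rewrite /nrm normrN. Qed.
Lemma nrmB x y : nrm (x - y) = nrm (y - x). Proof. by rewrite -opprB nrmN. Qed.
Lemma nrm0 : nrm (0 : V) = 0. Proof. by rewrite /nrm normr0 -toK0 toKK. Qed.
Lemma nrm_eq0 x : nrm x = 0 -> x = 0.
Proof. by move=> h; apply/eqP; rewrite -normr_eq0 -toK_nrm h toK0. Qed.
Lemma nrm_le0 x : (forall e, 0 < e -> nrm x <= e) -> x = 0.
Proof.
move=> h; apply: nrm_eq0; apply/eqP; rewrite eq_le nrm_ge0 andbT.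
by apply/ler_addgt0Pl => e e0; rewrite addr0; apply: h.
Qed.
End Nrm.

Lemma nrmZ (V : normedModType K) (a : K) (x : V) : nrm (a *: x) = nrm a * nrm x.
Proof. by rewrite -[LHS]toKK toK_nrm normrZ -!toK_nrm -toKM toKK. Qed.

Lemma nrmM (a b : K) : nrm (a * b) = nrm a * nrm b.
Proof. by rewrite -[LHS]toKK toK_nrm normrM -!toK_nrm -toKM toKK. Qed.

Lemma nrm1 : nrm (1 : K) = 1.
Proof. by rewrite /nrm normr1 -toK1 toKK. Qed.

Lemma ler_nrm (V W : normedZmodType K) (x : V) (y : W) :
  (nrm x <= nrm y) = (`|x| <= `|y|).
Proof. by rewrite -!toK_nrm ler_toK. Qed.

End Scalars.

Section Seminorms.
Context (R : realType) (k : scalar_kind).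
Local Notation K := (scalars R k).

Record seminorm (E : lmodType K) := Seminorm {
  snorm :> E -> R;
  snormD : forall x y, snorm (x + y) <= snorm x + snorm y;
  snormZ : forall (a : K) x, snorm (a *: x) = nrm a * snorm x;
}.

Section SeminormTheory.
Variables (E : lmodType K) (p : seminorm E).

Lemma snorm0 : p 0 = 0.
Proof. by rewrite -(scale0r (0 : E)) snormZ nrm0 mul0r. Qed.
Lemma snormN x : p (- x) = p x.
Proof. by rewrite -scaleN1r snormZ nrmN nrm1 mul1r. Qed.
Lemma snormB x y : p (x - y) = p (y - x).
Proof. by rewrite -opprB snormN. Qed.
Lemma snorm_ge0 x : 0 <= p x.
Proof.
have := snormD p x (- x); rewrite subrr snorm0 snormN -mulr2n.
by rewrite pmulrn_lge0.
Qed.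
Lemma snorm_tri y x z : p (x - z) <= p (x - y) + p (y - z).
Proof. by rewrite -[x - z](subrKA y); apply: snormD. Qed.
Lemma snorm_dist x y : p x <= p y + p (x - y).
Proof. by rewrite -{1}[x](subrKC y); apply: snormD. Qed.

Definition seq_cauchy (u : nat -> E) : Prop :=
  forall e : R, 0 < e ->
  exists N, forall m n, (N <= m)%N -> (N <= n)%N -> p (u m - u n) < e.

Definition seq_lim (u : nat -> E) (l : E) : Prop :=
  forall e : R, 0 < e -> exists N, forall n, (N <= n)%N -> p (u n - l) < e.

Definition seq_complete : Prop :=
  forall u, seq_cauchy u -> exists l, seq_lim u l.

Lemma seq_lim_cauchy u l : seq_lim u l -> seq_cauchy u.
Proof.
move=> ul e e0; have e20 : 0 < e / 2 by rewrite divr_gt0.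
have [N hN] := ul _ e20; exists N => m n Nm Nn.
rewrite (le_lt_trans (snorm_tri l _ _))// [e]splitr ltrD ?hN//.
by rewrite snormB hN.
Qed.

Lemma seq_limD u v l m :
  seq_lim u l -> seq_lim v m -> seq_lim (fun n => u n + v n) (l + m).
Proof.
move=> ul vm e e0; have e20 : 0 < e / 2 by rewrite divr_gt0.
have [N hN] := ul _ e20; have [M hM] := vm _ e20; exists (maxn N M) => n.
rewrite geq_max => /andP[Nn Mn]; rewrite opprD addrACA.
by rewrite (le_lt_trans (snormD _ _ _))// [e]splitr ltrD ?hN ?hM.
Qed.

Lemma seq_limZ a u l : seq_lim u l -> seq_lim (fun n => a *: u n) (a *: l).
Proof.
move=> ul e e0; have a1 : 0 < nrm a + 1 by rewrite ltr_wpDl ?nrm_ge0.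
have [N hN] := ul _ (divr_gt0 e0 a1); exists N => n Nn.
rewrite -scalerBr snormZ; apply: le_lt_trans (_ : (nrm a + 1) * p (u n - l) < e).
  by rewrite ler_wpM2r ?snorm_ge0// lerDl.
by rewrite mulrC -ltr_pdivlMr// hN.
Qed.

Lemma seq_lim_uniq u l m : seq_lim u l -> seq_lim u m -> p (l - m) = 0.
Proof.
move=> ul um; apply/eqP; rewrite eq_le snorm_ge0 andbT.
apply/ler_addgt0Pl => e e0; rewrite addr0; have e20 : 0 < e / 2 by rewrite divr_gt0.
have [N hN] := ul _ e20; have [M hM] := um _ e20.
pose n := maxn N M.
rewrite (le_trans (snorm_tri (u n) _ _))// [e]splitr lerD// ltW//.
  by rewrite snormB hN// leq_maxl.
by rewrite hM// leq_maxr.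
Qed.

End SeminormTheory.

Section InfSeminorm.
Variables (E : lmodType K) (S : E -> set R).
Hypothesis S_nonempty : forall x, S x !=set0.
Hypothesis S_ge0 : forall x r, S x r -> 0 <= r.
Hypothesis SD : forall x y r s, S x r -> S y s -> S (x + y) (r + s).
Hypothesis SZ : forall (a : K) x r, S x r -> S (a *: x) (nrm a * r).

Let S_lb x : has_lbound (S x).
Proof. by exists 0 => r; apply: S_ge0. Qed.

Let S_inf x : has_inf (S x). Proof. by split. Qed.

Lemma inf_snorm_le x r : S x r -> inf (S x) <= r.
Proof. exact: ge_inf. Qed.

Lemma inf_snorm_ge x c : (forall r, S x r -> c <= r) -> c <= inf (S x).
Proof. exact: lb_le_inf. Qed.

Let infD x y : inf (S (x + y)) <= inf (S x) + inf (S y).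
Proof.
rewrite -lerBlDr; apply: inf_snorm_ge => r Sr.
rewrite lerBlDr -lerBlDl; apply: inf_snorm_ge => s Ss.
by rewrite lerBlDl inf_snorm_le//; apply: SD.
Qed.

Let infZ_le (a : K) x : inf (S (a *: x)) <= nrm a * inf (S x).
Proof.
have [->|a0] := eqVneq a 0.
  rewrite scale0r nrm0 mul0r; have [r Sr] := S_nonempty 0.
  by have := SZ 0 Sr; rewrite scale0r nrm0 mul0r; apply: inf_snorm_le.
have na0 : 0 < nrm a.
  rewrite lt_neqAle nrm_ge0 andbT eq_sym; apply/eqP => /nrm_eq0 h.
  by rewrite h eqxx in a0.
rewrite mulrC -ler_pdivrMr//; apply: inf_snorm_ge => r Sr.
by rewrite ler_pdivrMr// mulrC; apply: inf_snorm_le; apply: SZ.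
Qed.

Let infZ (a : K) x : inf (S (a *: x)) = nrm a * inf (S x).
Proof.
apply/eqP; rewrite eq_le infZ_le /=.
have [->|a0] := eqVneq a 0.
  rewrite nrm0 mul0r; apply: inf_snorm_ge => r; exact: S_ge0.
rewrite -{1}[x](scalerK a0) (le_trans (ler_wpM2l (nrm_ge0 a) (infZ_le _ _)))//.
by rewrite mulrA -nrmM divff// nrm1 mul1r.
Qed.

Definition inf_seminorm : seminorm E := Seminorm infD infZ.

End InfSeminorm.

End Seminorms.

Section BanachOfSeminorm.
Context (R : realType) (k : scalar_kind).
Local Notation K := (scalars R k).

Definition norm_seminorm (V : normedModType K) : seminorm V :=
  Seminorm (@nrmD R k V) (@nrmZ R k V).

Lemma inv_lt (e : R) : 0 < e -> exists N, forall n, (N <= n)%N -> n.+1%:R^-1 < e.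
Proof.
move=> e0; have [N _ hN] := near_infty_natSinv_lt (PosNum e0).
by exists N => n Nn; apply: hN.
Qed.

Lemma seq_complete_cvg (V : normedModType K) :
  seq_complete (norm_seminorm V) ->
  forall F : set_system V, ProperFilter F -> cauchy F -> cvg F.
Proof.
move=> Vc F FF /cauchy_ballP Fc.
have {}Fc : cauchy_ex F by apply/cauchyP/cauchy_ballP.
have /choice [u hu] : forall n, exists x : V, F (ball x (toK k n.+1%:R^-1)).
  by move=> n; apply: Fc; rewrite -(toK0 R k) ltr_toK invr_gt0.
have ballE (x y : V) r : ball x (toK k r) y = (nrm (x - y) < r) :> Prop.
  by rewrite -ball_normE /ball_/= -toK_nrm ltr_toK.
have [l ul] : exists l, seq_lim (norm_seminorm V) u l.
  apply: Vc => e e0; have e20 : 0 < e / 2 by rewrite divr_gt0.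
  have [N hN] := inv_lt e20; exists N => m n Nm Nn.
  have [y []] := filter_ex (filterI (hu m) (hu n)); rewrite !ballE => um un.
  rewrite (le_lt_trans (snorm_tri (norm_seminorm V) y _ _))// [e]splitr ltrD//=.
    by rewrite (lt_trans um)// hN.
  by rewrite nrmB (lt_trans un)// hN.
apply/cvg_ex; exists l; apply/cvg_ballP => e e0.
have re0 : 0 < reK e by rewrite -(ltr_toK k) toK0 reKK// ltW.
have re20 : 0 < reK e / 2 by rewrite divr_gt0.
have [N hN] := inv_lt re20; have [M hM] := ul _ re20; pose n := maxn N M.
apply: filterS (hu n) => y; rewrite ballE => uny.
rewrite -(reKK (ltW e0)) ballE.
rewrite (le_lt_trans (snorm_tri (norm_seminorm V) (u n) _ _))//= [reK e]splitr.
rewrite ltrD//.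
  by rewrite nrmB; apply: hM; rewrite leq_maxr.
by rewrite (lt_trans uny)// hN// leq_maxl.
Qed.

Lemma banach_seq_complete (V : completeNormedModType K) :
  seq_complete (norm_seminorm V).
Proof.
move=> u uc.
have /cauchy_cvg/cvg_ex[l ul] : cauchy (u @ \oo).
  apply/cauchyP => e e0.
  have re0 : 0 < reK e by rewrite -(ltr_toK k) toK0 reKK// ltW.
  have [N hN] := uc _ re0; exists (u N); exists N => // n /= Nn.
  rewrite -ball_normE /ball_/= -(reKK (ltW e0)) -toK_nrm ltr_toK.
  exact: hN.
exists l => e e0; have e0' : 0 < toK k e by rewrite -(toK0 R k) ltr_toK.
move/cvg_ballP : ul => /(_ _ e0')[N _ hN]; exists N => n Nn.
have := hN n Nn; rewrite /= -ball_normE /ball_/= -toK_nrm ltr_toK.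
by rewrite /= nrmB.
Qed.

Section Builder.
Variables (E : lmodType K) (p : seminorm E).

Definition banach_carrier of (forall x, p x = 0 -> x = 0) & seq_complete p
  : Type := E.

Hypothesis p_eq0 : forall x, p x = 0 -> x = 0.
Hypothesis p_complete : seq_complete p.
Local Notation T := (banach_carrier p_eq0 p_complete).

HB.instance Definition _ := GRing.Lmodule.copy T E.

Let normT (x : T) : K := toK k (p x).
Let normTD (x y : T) : normT (x + y) <= normT x + normT y.
Proof. by rewrite /normT -toKD ler_toK snormD. Qed.
Let normTZ (a : K) (x : T) : normT (a *: x) = `|a| * normT x.
Proof. by rewrite /normT snormZ toKM toK_nrm. Qed.
Let normT0 (x : T) : normT x = 0 -> x = 0.
Proof.
by rewrite /normT -(toK0 R k) => /(congr1 (@reK R k)); rewrite !toKK => /p_eq0.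
Qed.

HB.instance Definition _ := Lmodule_isNormed.Build K T normTD normTZ normT0.

Let nrmT (x : T) : nrm x = p x. Proof. by rewrite /nrm/= toKK. Qed.

Let T_complete : seq_complete (norm_seminorm T).
Proof.
move=> u uc; have [|l ul] := p_complete (u := u).
  by move=> e e0; have [N hN] := uc e e0; exists N => m n Nm Nn;
    have := hN m n Nm Nn; rewrite /= nrmT.
by exists l => e e0; have [N hN] := ul e e0; exists N => n Nn; rewrite /= nrmT hN.
Qed.

HB.instance Definition _ := Uniform_isComplete.Build T (seq_complete_cvg T_complete).

Definition banach_of_norm : completeNormedModType K := T.

Lemma nrm_banach_of_norm (x : banach_of_norm) : nrm x = p x.
Proof. exact: nrmT. Qed.

End Builder.
End BanachOfSeminorm.

Section HausdorffQuotient.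
Context (R : realType) (k : scalar_kind).
Local Notation K := (scalars R k).
Local Open Scope quotient_scope.
Variables (E : lmodType K) (p : seminorm E).

Definition snorm_ker : {pred E} := fun x => p x == 0.
Local Notation ker := snorm_ker.

Let ker_zmod_closed : zmod_closed ker.
Proof.
split=> [|x y]; rewrite !unfold_in; first by rewrite snorm0.
move=> /eqP px /eqP py; rewrite eq_le snorm_ge0 andbT.
by rewrite (le_trans (snormD _ _ _))// snormN px py addr0.
Qed.

HB.instance Definition _ := GRing.isZmodClosed.Build E ker ker_zmod_closed.

Definition hausdorff_carrier : Type := Quotient.quot ker.
Local Notation Q := hausdorff_carrier.
HB.instance Definition _ := GRing.Zmodule.copy Q (Quotient.quot ker).
Let cls : E -> Q := \pi_(Quotient.quot ker).
Let rpr : Q -> E := fun x => repr (x : Quotient.quot ker).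

Let rprK x : cls (rpr x) = x. Proof. exact: reprK. Qed.
Let clsD x y : cls (x + y) = cls x + cls y.
Proof. by rewrite /cls; rewrite !piE. Qed.
Let cls_eq x y : p (x - y) = 0 <-> cls x = cls y.
Proof.
split=> [h|h].
  by apply/eqP; rewrite -Quotient.idealrBE unfold_in h.
by apply/eqP; have /eqP := h; rewrite -Quotient.idealrBE unfold_in.
Qed.
Let rpr_cls x : p (rpr (cls x) - x) = 0.
Proof. by apply/cls_eq; rewrite rprK. Qed.

Let scaleQ (a : K) (x : Q) : Q := cls (a *: rpr x).
Let scaleE a x : scaleQ a (cls x) = cls (a *: x).
Proof. by apply/cls_eq; rewrite -scalerBr snormZ rpr_cls mulr0. Qed.
Let scaleA a b x : scaleQ a (scaleQ b x) = scaleQ (a * b) x.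
Proof. by rewrite -(rprK x) !scaleE scalerA. Qed.
Let scale1 x : scaleQ 1 x = x.
Proof. by rewrite -(rprK x) scaleE scale1r. Qed.
Let scaleDr a : {morph scaleQ a : x y / x + y}.
Proof. by move=> x y; rewrite -(rprK x) -(rprK y) -clsD !scaleE scalerDr clsD. Qed.
Let scaleDl x : {morph scaleQ^~ x : a b / a + b}.
Proof. by move=> a b; rewrite -(rprK x) !scaleE scalerDl clsD. Qed.
HB.instance Definition _ :=
  GRing.Zmodule_isLmodule.Build K Q scaleA scale1 scaleDr scaleDl.

Let normQ (x : Q) : R := p (rpr x).
Let normQE x : normQ (cls x) = p x.
Proof.
apply/eqP; rewrite eq_le; apply/andP; split.
  by rewrite -[leRHS]addr0 -(rpr_cls x) snorm_dist.
by rewrite -[leRHS]addr0 -(rpr_cls x) snormB snorm_dist.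
Qed.
Let normQD x y : normQ (x + y) <= normQ x + normQ y.
Proof. by rewrite -(rprK x) -(rprK y) -clsD !normQE snormD. Qed.
Let normQZ (a : K) x : normQ (a *: x) = nrm a * normQ x.
Proof. by rewrite -(rprK x) [_ *: _]scaleE !normQE snormZ. Qed.
Let snormQ : seminorm (Q : lmodType K) := @Seminorm R k Q normQ normQD normQZ.

Let normQ0 (x : Q) : snormQ x = 0 -> x = 0.
Proof.
move=> h; rewrite -(rprK x) -[RHS]rprK; apply/cls_eq.
have r0 : p (rpr 0) = 0.
  have : cls 0 = 0 by apply: (addrI (cls 0)); rewrite -clsD !addr0.
  by move=> <-; rewrite [LHS]normQE snorm0.
apply/eqP; rewrite eq_le snorm_ge0 andbT (le_trans (snormD _ _ _))//.
by rewrite snormN r0 addr0 [p _]h.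
Qed.

Hypothesis p_complete : seq_complete p.

Let snormQ_complete : seq_complete snormQ.
Proof.
move=> u uc.
have subE x y : x - y = cls (rpr x - rpr y).
  by rewrite -{1}(rprK x) -{1}(rprK y) /cls !piE.
have [|l ul] := p_complete (u := fun n => rpr (u n)).
  move=> e e0; have [N hN] := uc e e0; exists N => m n Nm Nn.
  by have := hN m n Nm Nn; rewrite subE /= normQE.
exists (cls l) => e e0; have [N hN] := ul e e0; exists N => n Nn.
have -> : u n - cls l = cls (rpr (u n) - l).
  by rewrite -{1}(rprK (u n)) /cls !piE.
by rewrite /= normQE hN.
Qed.

(* The quotient of E by the kernel of p, normed by p. *)
Definition hausdorff : completeNormedModType K :=
  banach_of_norm normQ0 snormQ_complete.

Definition hausdorff_pi (x : E) : hausdorff := cls x.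

Lemma hausdorff_pi_linear : linear hausdorff_pi.
Proof. by move=> a x y; rewrite /hausdorff_pi clsD -scaleE. Qed.

Lemma hausdorff_pi_nrm x : nrm (hausdorff_pi x) = p x.
Proof. by rewrite nrm_banach_of_norm; apply: normQE. Qed.

Lemma hausdorff_pi_surj (y : hausdorff) : exists x, hausdorff_pi x = y.
Proof. by exists (rpr y); apply: rprK. Qed.

End HausdorffQuotient.

Section Completion.
Context (R : realType) (k : scalar_kind).
Local Notation K := (scalars R k).

Lemma hausdorff_lift (E : lmodType K) (p : seminorm E) (pc : seq_complete p)
    (X : normedModType K) (g : E -> X) (C : R) :
  linear g -> (forall x, nrm (g x) <= C * p x) ->
  exists h : hausdorff pc -> X,
    [/\ linear h, forall y, nrm (h y) <= C * nrm y &
        forall x, h (hausdorff_pi pc x) = g x].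
Proof.
move=> gL gC; have [s sK] := choice (@hausdorff_pi_surj R k E p pc).
have g_eq x y : hausdorff_pi pc x = hausdorff_pi pc y -> g x = g y.
  move=> xy; apply/eqP; rewrite -subr_eq0 -normr_eq0; apply/eqP.
  have gB : g x - g y = g (x - y).
    by rewrite -(scaleN1r y) [x + _]addrC gL scaleN1r addrC.
  rewrite gB -toK_nrm -[RHS](toK0 R k); congr toK; apply/eqP.
  rewrite eq_le nrm_ge0 andbT (le_trans (gC _))// -(hausdorff_pi_nrm pc).
  rewrite -(scaleN1r y) [x + _]addrC hausdorff_pi_linear xy scaleN1r addNr.
  by rewrite nrm0 mulr0.
have hK x : g (s (hausdorff_pi pc x)) = g x by apply: g_eq.
exists (fun y => g (s y)); split => //.
- by move=> a x y; rewrite -gL; apply: g_eq; rewrite hausdorff_pi_linear !sK.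
- by move=> y; rewrite (le_trans (gC _))// -(hausdorff_pi_nrm pc) sK.
Qed.

Variables (E : lmodType K) (p : seminorm E).

Definition cauchy_seqs : {pred (nat -> E)} := fun u => `[< seq_cauchy p u >].

Let cauchy_seqs_closed : submod_closed cauchy_seqs.
Proof.
split=> [|a u v].
  rewrite unfold_in; apply/asboolP => e e0; exists 0%N => m n _ _.
  by rewrite subrr snorm0.
rewrite !unfold_in => /asboolP uc /asboolP vc; apply/asboolP => e e0.
have e20 : 0 < e / 2 by rewrite divr_gt0.
have a1 : 0 < nrm a + 1 by rewrite ltr_wpDl ?nrm_ge0.
have [N hN] := uc _ (divr_gt0 e20 a1); have [M hM] := vc _ e20.
exists (maxn N M) => m n; rewrite !geq_max => /andP[Nm Mm] /andP[Nn Mn].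
have -> : (a *: u + v) m - (a *: u + v) n = a *: (u m - u n) + (v m - v n).
  by rewrite opprD addrACA scalerBr.
rewrite (le_lt_trans (snormD _ _ _))// [e]splitr ltrD//; last exact: hM.
rewrite snormZ; apply: le_lt_trans (_ : (nrm a + 1) * p (u m - u n) < _).
  by rewrite ler_wpM2r ?snorm_ge0// lerDl.
by rewrite mulrC -ltr_pdivlMr// hN.
Qed.

HB.instance Definition _ :=
  GRing.isSubmodClosed.Build K (nat -> E) cauchy_seqs cauchy_seqs_closed.

Definition cauchy_seq_type : Type := {u : nat -> E | u \in cauchy_seqs}.
Local Notation CS := cauchy_seq_type.
HB.instance Definition _ := [isSub of CS for @proj1_sig _ _].
HB.instance Definition _ := [Choice of CS by <:].
HB.instance Definition _ := [SubChoice_isSubLmodule of CS by <:].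

(* For a Cauchy sequence u, the infimum of the eventual upper bounds of p (u n)
   is their limit. *)
Let eventual_bounds (u : CS) : set R :=
  [set c | 0 <= c /\ exists N, forall n, (N <= n)%N -> p (val u n) <= c].

Let CScauchy (u : CS) : seq_cauchy p (val u).
Proof. by apply/asboolP; exact: (valP u). Qed.

Let eb0 u : eventual_bounds u !=set0.
Proof.
have [N hN] := CScauchy u ltr01; exists (p (val u N) + 1); split.
  by rewrite addr_ge0 ?snorm_ge0.
exists N => n Nn; rewrite (le_trans (snorm_dist _ _ (val u N)))// lerD2l ltW//.
exact: hN.
Qed.
Let eb_ge0 u r : eventual_bounds u r -> 0 <= r. Proof. by case. Qed.
Let ebD u v r s : eventual_bounds u r -> eventual_bounds v s ->
  eventual_bounds (u + v) (r + s).
Proof.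
move=> [r0 [N hN]] [s0 [M hM]]; split; first exact: addr_ge0.
exists (maxn N M) => n; rewrite geq_max => /andP[Nn Mn].
by rewrite (le_trans (snormD _ _ _))// lerD ?hN ?hM.
Qed.
Let ebZ (a : K) u r : eventual_bounds u r -> eventual_bounds (a *: u) (nrm a * r).
Proof.
move=> [r0 [N hN]]; split; first by rewrite mulr_ge0 ?nrm_ge0.
by exists N => n Nn; rewrite snormZ ler_wpM2l ?nrm_ge0 ?hN.
Qed.

Let snormCS : seminorm (CS : lmodType K) := inf_seminorm eb0 eb_ge0 ebD ebZ.

Let cst (x : E) : CS.
Proof.
exists (fun=> x); rewrite unfold_in; apply/asboolP => e e0; exists 0%N => m n _ _.
by rewrite subrr snorm0.
Defined.

Let snormCS_le u c N :
  (forall n, (N <= n)%N -> p (val u n) <= c) -> snormCS u <= c.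
Proof.
move=> h; apply: inf_snorm_le => //; split; last by exists N.
by rewrite (le_trans (snorm_ge0 p (val u N)))// h.
Qed.

Let snormCS_lt u c : snormCS u < c ->
  exists N, forall n, (N <= n)%N -> p (val u n) < c.
Proof.
move=> uc; have [r [_ [N hN]] rc] : exists2 r, eventual_bounds u r & r < c.
  by apply: inf_lt => //; split=> //; exists 0 => ? [].
by exists N => n Nn; apply: le_lt_trans rc; apply: hN.
Qed.

Let snormCS_complete : seq_complete snormCS.
Proof.
move=> U Uc.
have tail n : exists m, forall i j, (m <= i)%N -> (m <= j)%N ->
    p (val (U n) i - val (U n) j) < n.+1%:R^-1.
  by apply: CScauchy; rewrite invr_gt0.
have [m hm] := choice tail; pose d n := val (U n) (m n).
have dU n e : n.+1%:R^-1 < e ->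
    forall i, (m n <= i)%N -> p (d n - val (U n) i) < e.
  by move=> ne i mi; apply: lt_trans ne; apply: hm.
have dc : seq_cauchy p d.
  move=> e e0; have e30 : 0 < e / 3 by rewrite divr_gt0.
  have [N hN] := inv_lt e30; have [M hM] := Uc _ e30.
  exists (maxn N M) => i j; rewrite !geq_max => /andP[Ni Mi] /andP[Nj Mj].
  have [L hL] := snormCS_lt (hM i j Mi Mj).
  pose n := maxn L (maxn (m i) (m j)).
  have := hL n (leq_maxl _ _) => hU.
  have h1 := dU i _ (hN i Ni) n (leq_trans (leq_maxl _ _) (leq_maxr _ _)).
  have h2 := dU j _ (hN j Nj) n (leq_trans (leq_maxr _ _) (leq_maxr _ _)).
  rewrite snormB in h2.
  apply: (le_lt_trans (snorm_tri p (val (U i) n) _ _)).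
  rewrite (_ : e = e / 3 + (e / 3 + e / 3)); last by lra.
  by rewrite ltrD// (le_lt_trans (snorm_tri p (val (U j) n) _ _))// ltrD.
have dP : d \in cauchy_seqs by apply/asboolP.
exists (exist _ d dP) => e e0; have e30 : 0 < e / 3 by rewrite divr_gt0.
have [N hN] := inv_lt e30; have [M hM] := dc _ e30.
exists (maxn N M) => n; rewrite geq_max => /andP[Nn Mn].
apply: (@le_lt_trans _ _ (e / 3 + e / 3)); last first.
  by lra.
apply: (@snormCS_le _ _ (maxn M (m n))) => i; rewrite geq_max => /andP[Mi mi].
rewrite (_ : val _ i = val (U n) i - d i)//.
rewrite (le_trans (snorm_tri p (d n) _ _))// lerD// ltW//.
  by rewrite snormB; apply: dU => //; apply: hN.
exact: hM.
Qed.

(* The Hausdorff completion of E for the seminorm p. *)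
Definition completion : completeNormedModType K := hausdorff snormCS_complete.

Definition completion_in (x : E) : completion :=
  hausdorff_pi snormCS_complete (cst x).

Lemma completion_in_linear : linear completion_in.
Proof.
move=> a x y; rewrite /completion_in -hausdorff_pi_linear; congr hausdorff_pi.
exact: val_inj.
Qed.

Lemma completion_in_nrm x : nrm (completion_in x) = p x.
Proof.
rewrite hausdorff_pi_nrm; apply/eqP; rewrite eq_le; apply/andP; split.
  exact: (@snormCS_le _ _ 0%N).
apply: inf_snorm_ge => // r [_ [N /(_ N (leqnn N))]] //.
Qed.

Lemma completion_in_dense (y : completion) (e : R) :
  0 < e -> exists x, nrm (y - completion_in x) < e.
Proof.
move=> e0; have e20 : 0 < e / 2 by rewrite divr_gt0.
have [u <-] := hausdorff_pi_surj y; have [N hN] := CScauchy u e20.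
exists (val u N); rewrite /completion_in addrC -scaleN1r -hausdorff_pi_linear.
rewrite hausdorff_pi_nrm; apply: (@le_lt_trans _ _ (e / 2)).
  apply: (@snormCS_le _ _ N) => n Nn.
  rewrite (_ : val _ n = -1 *: val u N + val u n)// scaleN1r addrC ltW//.
  exact: hN.
by rewrite ltr_pdivrMr// mulr_natr mulr2n ltrDl.
Qed.

Lemma completion_lift (X : completeNormedModType K) (g : E -> X) (C : R) :
  0 <= C -> linear g -> (forall x, nrm (g x) <= C * p x) ->
  exists h : completion -> X,
    [/\ linear h, forall y, nrm (h y) <= C * nrm y &
        forall x, h (completion_in x) = g x].
Proof.
move=> C0 gL gC.
have C1 : 0 < C + 1 by rewrite ltr_wpDl.
have gB x y : g x - g y = g (x - y).
  by rewrite -(scaleN1r y) [x + _]addrC gL scaleN1r addrC.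
have glim (u : CS) : exists l, seq_lim (norm_seminorm X) (g \o val u) l.
  apply: banach_seq_complete => e e0.
  have [N hN] := CScauchy u (divr_gt0 e0 C1); exists N => m n Nm Nn /=.
  rewrite gB (le_lt_trans (gC _))//.
  apply: le_lt_trans (_ : (C + 1) * p (val u m - val u n) < e).
    by rewrite ler_wpM2r ?snorm_ge0// lerDl.
  by rewrite mulrC -ltr_pdivlMr// hN.
have [G hG] := choice glim.
have lim_uniq v l l' : seq_lim (norm_seminorm X) v l ->
    seq_lim (norm_seminorm X) v l' -> l = l'.
  by move=> h h'; apply/eqP; rewrite -subr_eq0; apply/eqP/(@nrm_eq0 R k)/(seq_lim_uniq h h').
have GL : linear G.
  move=> a u v; apply: (lim_uniq (g \o val (a *: u + v))); first exact: hG.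
  rewrite (_ : _ \o _ = fun n => a *: (g \o val u) n + (g \o val v) n).
    by apply: seq_limD => //; apply: (@seq_limZ R k X (norm_seminorm X)).
  by apply/funext => n /=; rewrite -gL.
have GC u : nrm (G u) <= C * snormCS u.
  apply/ler_addgt0Pr => e e0; have e20 : 0 < e / 2 by rewrite divr_gt0.
  have hu : snormCS u < snormCS u + e / 2 / (C + 1).
    by rewrite ltrDl !divr_gt0.
  have [N hN] := snormCS_lt hu; have [M hM] := hG u _ e20.
  pose n := maxn N M.
  have := snorm_dist (norm_seminorm X) (G u) (g (val u n)) => /= /le_trans -> //.
  rewrite [leRHS](_ : _ = C * snormCS u + e / 2 + e / 2); last by lra.
  rewrite lerD//; last first.
    by rewrite nrmB ltW// hM// leq_maxr.
  rewrite (le_trans (gC _))//.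
  rewrite (le_trans (ler_wpM2l C0 (ltW (hN n (leq_maxl _ _)))))// mulrDr lerD2l.
  by rewrite mulrCA ger_pMr// ler_pdivrMr// mul1r lerDl.
have [h [hL hC hE]] := hausdorff_lift snormCS_complete GL GC.
exists h; split => // x; rewrite hE; apply: lim_uniq (hG _) _ => e e0.
by exists 0%N => n _ /=; rewrite subrr nrm0.
Qed.

End Completion.

Section ScalarsComplete.
Context (R : realType) (k : scalar_kind).
Local Notation K := (scalars R k).

Lemma scalars_seq_complete : seq_complete (norm_seminorm (K^o : normedModType K)).
Proof.
have Rc := @banach_seq_complete R RealScalars (R^o : completeNormedModType R).
case: k => // u uc.
have nrmE (a b : R) : nrm (Complex a b : R[i]^o : normedModType (scalars R ComplexScalars))
  = Num.sqrt (a ^+ 2 + b ^+ 2) by [].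
have sqle (a b : R) : `|a| <= Num.sqrt (a ^+ 2 + b ^+ 2).
  by rewrite -sqrtr_sqr ler_sqrt ?addr_ge0 ?sqr_ge0// lerDl sqr_ge0.
have lesq (a b : R) : Num.sqrt (a ^+ 2 + b ^+ 2) <= `|a| + `|b|.
  rewrite -[leRHS]ger0_norm ?addr_ge0// -sqrtr_sqr ler_sqrt ?sqr_ge0//.
  rewrite -(real_normK (num_real a)) -(real_normK (num_real b)).
  by rewrite sqrrD addrAC lerDl mulrn_wge0 ?mulr_ge0.
have [a ha] : exists a, seq_lim
    (norm_seminorm (k := RealScalars) (R^o : normedModType R)) (fun n => complex.Re (u n)) a.
  apply: Rc => e e0; have [N hN] := uc e e0; exists N => m n Nm Nn.
  apply: le_lt_trans (hN m n Nm Nn) => /=.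
  by case: (u m) (u n) => [a b] [c d]; apply: sqle.
have [b hb] : exists b, seq_lim
    (norm_seminorm (k := RealScalars) (R^o : normedModType R)) (fun n => complex.Im (u n)) b.
  apply: Rc => e e0; have [N hN] := uc e e0; exists N => m n Nm Nn.
  apply: le_lt_trans (hN m n Nm Nn) => /=.
  case: (u m) (u n) => [a' b] [c d].
  by apply: le_trans (sqle _ (a' - c)) _; rewrite [X in Num.sqrt X]addrC.
exists (Complex a b) => e e0; have e20 : 0 < e / 2 by rewrite divr_gt0.
have [N hN] := ha _ e20; have [M hM] := hb _ e20; exists (maxn N M) => n.
rewrite geq_max => /andP[Nn Mn].
move: (hN n Nn) (hM n Mn); case: (u n) => c d /= hc hd.
by rewrite (le_lt_trans (lesq _ _))// [e]splitr ltrD.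
Qed.

Definition scalar_carrier : Type := K^o.
HB.instance Definition _ := NormedModule.copy scalar_carrier K^o.
HB.instance Definition _ :=
  Uniform_isComplete.Build scalar_carrier (seq_complete_cvg scalars_seq_complete).

(* The scalar field as a one-dimensional Banach space. *)
Definition scalar_space : completeNormedModType K := scalar_carrier.

End ScalarsComplete.

Section InternalHom.
Context (R : realType) (k : scalar_kind).
Local Notation K := (scalars R k).

Section BoundedMaps.
Variables (V W : completeNormedModType K).

Definition bounded_map : {pred (V -> W)} := fun f =>
  `[< linear f /\ exists C : R, forall x, nrm (f x) <= C * nrm x >].

Let bounded_map_closed : submod_closed bounded_map.
Proof.
split=> [|a f g]; rewrite !unfold_in.
  apply/asboolP; split=> [b x y|]; first by rewrite scaler0 addr0.
  by exists 0 => x; rewrite mul0r nrm0.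
move=> /asboolP[fL [C fC]] /asboolP[gL [D gD]]; apply/asboolP; split.
  move=> b x y; rewrite /= !fctE fL gL !scalerDr !scalerA mulrC -!addrA.
  by congr (_ + _); rewrite addrCA.
exists (nrm a * C + D) => x; rewrite mulrDl.
by rewrite (le_trans (nrmD _ _))// lerD// nrmZ -mulrA ler_wpM2l ?nrm_ge0.
Qed.

HB.instance Definition _ :=
  GRing.isSubmodClosed.Build K (V -> W) bounded_map bounded_map_closed.

Definition bounded_map_type : Type := {f : V -> W | f \in bounded_map}.
HB.instance Definition _ := [isSub of bounded_map_type for @proj1_sig _ _].
HB.instance Definition _ := [Choice of bounded_map_type by <:].
HB.instance Definition _ := [SubChoice_isSubLmodule of bounded_map_type by <:].

Let bmP (f : bounded_map_type) :
  linear (val f) /\ exists C : R, forall x, nrm (val f x) <= C * nrm x.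
Proof. exact/asboolP/(valP f). Qed.

Definition operator_bounds (f : bounded_map_type) : set R :=
  [set C | 0 <= C /\ forall x, nrm (val f x) <= C * nrm x].

Let bounds0 f : operator_bounds f !=set0.
Proof.
have [_ [C hC]] := bmP f; exists `|C|; split => // x.
by rewrite (le_trans (hC x))// ler_wpM2r ?nrm_ge0// ler_norm.
Qed.
Let bounds_ge0 f C : operator_bounds f C -> 0 <= C. Proof. by case. Qed.
Let boundsD f g C D : operator_bounds f C -> operator_bounds g D -> operator_bounds (f + g) (C + D).
Proof.
move=> [C0 fC] [D0 gD]; split; first exact: addr_ge0.
by move=> x; rewrite mulrDl (le_trans (nrmD _ _))// lerD.
Qed.
Let boundsZ (a : K) f C : operator_bounds f C -> operator_bounds (a *: f) (nrm a * C).
Proof.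
move=> [C0 fC]; split; first by rewrite mulr_ge0 ?nrm_ge0.
by move=> x; rewrite nrmZ -mulrA ler_wpM2l ?nrm_ge0.
Qed.

Definition operator_norm : seminorm (bounded_map_type : lmodType K) :=
  inf_seminorm bounds0 bounds_ge0 boundsD boundsZ.

Let opnormP f x : nrm (val f x) <= operator_norm f * nrm x.
Proof.
have [x0|x0] := eqVneq (nrm x) 0.
  by have [_ [C /(_ x)]] := bmP f; rewrite x0 !mulr0.
have {}x0 : 0 < nrm x by rewrite lt_neqAle eq_sym x0 nrm_ge0.
rewrite -ler_pdivrMr//; apply: inf_snorm_ge => // C [_ /(_ x) h].
by rewrite ler_pdivrMr.
Qed.

Let opnorm_le f C : 0 <= C -> (forall x, nrm (val f x) <= C * nrm x) ->
  operator_norm f <= C.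
Proof. by move=> C0 h; apply: inf_snorm_le. Qed.

Let opnorm_eq0 f : operator_norm f = 0 -> f = 0.
Proof.
move=> f0; apply/val_inj/funext => x; apply: (@nrm_eq0 R k).
by apply/eqP; rewrite eq_le nrm_ge0 andbT (le_trans (opnormP _ _))// f0 mul0r.
Qed.

Let opnorm_complete : seq_complete operator_norm.
Proof.
move=> u uc.
have sub_nrm m n x : nrm (val (u m) x - val (u n) x) <= operator_norm (u m - u n) * nrm x.
  exact: opnormP (u m - u n) x.
have lim x : exists l, seq_lim (norm_seminorm W) (fun n => val (u n) x) l.
  apply: banach_seq_complete => e e0.
  have x1 : 0 < nrm x + 1 by rewrite ltr_wpDl ?nrm_ge0.
  have [N hN] := uc _ (divr_gt0 e0 x1); exists N => m n Nm Nn /=.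
  rewrite (le_lt_trans (sub_nrm _ _ _))//.
  apply: le_lt_trans (_ : operator_norm (u m - u n) * (nrm x + 1) < e).
    by rewrite ler_wpM2l ?snorm_ge0// lerDl.
  by rewrite -ltr_pdivlMr// hN.
have [f hf] := choice lim.
have lim_uniq v l l' : seq_lim (norm_seminorm W) v l ->
    seq_lim (norm_seminorm W) v l' -> l = l'.
  by move=> h h'; apply/eqP; rewrite -subr_eq0; apply/eqP/(@nrm_eq0 R k)/(seq_lim_uniq h h').
have fL : linear f.
  move=> a x y; apply: lim_uniq (hf _) _.
  rewrite (_ : (fun n => _) = fun n => a *: val (u n) x + val (u n) y).
    by apply: seq_limD => //; apply: (@seq_limZ R k W (norm_seminorm W)).
  by apply/funext => n /=; have [-> _] := bmP (u n).
have dist e : 0 < e -> exists N, forall n, (N <= n)%N ->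
    forall x, nrm (val (u n) x - f x) <= e * nrm x.
  move=> e0; have [N hN] := uc _ e0; exists N => n Nn x.
  apply/ler_addgt0Pr => d d0; have [M hM] := hf x _ d0; pose m := maxn N M.
  have := snorm_tri (norm_seminorm W) (val (u m) x) (val (u n) x) (f x) => /=.
  move=> /le_trans -> //; apply: lerD; last by rewrite ltW// hM// leq_maxr.
  rewrite (le_trans (sub_nrm _ _ _))// ler_wpM2r ?nrm_ge0// ltW//.
  by rewrite hN// leq_maxl.
have fP : f \in bounded_map.
  apply/asboolP; split => //; have [N /(_ N (leqnn N)) hN] := dist 1 ltr01.
  have [_ [C hC]] := bmP (u N); exists (C + 1) => x.
  have := snorm_dist (norm_seminorm W) (f x) (val (u N) x) => /= /le_trans -> //.
  by rewrite mulrDl; apply: lerD; [exact: hC|rewrite nrmB; exact: hN].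
exists (exist _ f fP) => e e0; have e20 : 0 < e / 2 by rewrite divr_gt0.
have [N hN] := dist _ e20; exists N => n Nn.
apply: (@le_lt_trans _ _ (e / 2)); last by lra.
by apply: opnorm_le; [exact: ltW|move=> x; apply: hN].
Qed.

Definition internal_hom : completeNormedModType K :=
  banach_of_norm opnorm_eq0 opnorm_complete.

Definition ihom_fun (f : internal_hom) : V -> W := val (f : bounded_map_type).

Lemma ihom_linear f : linear (ihom_fun f).
Proof. by have [] := bmP f. Qed.

Lemma ihom_bound f x : `|ihom_fun f x| <= `|f| * `|x|.
Proof.
rewrite -[in leRHS](toK_nrm x) -(toK_nrm f) -toK_nrm -toKM ler_toK.
by rewrite nrm_banach_of_norm; apply: opnormP.
Qed.

Lemma ihom_norm_le f (C : R) :
  0 <= C -> (forall x, nrm (ihom_fun f x) <= C * nrm x) -> nrm f <= C.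
Proof. by move=> C0 h; rewrite nrm_banach_of_norm; apply: opnorm_le. Qed.

Lemma ihom_ext f g : (forall x, ihom_fun f x = ihom_fun g x) -> f = g.
Proof. by move=> h; apply/val_inj/funext. Qed.

Definition mk_ihom (f : V -> W) (fL : linear f) (C : R)
    (fC : forall x, nrm (f x) <= C * nrm x) : internal_hom :=
  exist _ f (asboolT (conj fL (ex_intro _ C fC))).

Lemma mk_ihomE f (fL : linear f) C (fC : forall x, nrm (f x) <= C * nrm x) x :
  ihom_fun (mk_ihom fL fC) x = f x.
Proof. by []. Qed.

Lemma ihom_lin a f g x :
  ihom_fun (a *: f + g) x = a *: ihom_fun f x + ihom_fun g x.
Proof. by []. Qed.

End BoundedMaps.
End InternalHom.

Section LinearSpan.
Context (R : realType) (k : scalar_kind).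
Local Notation K := (scalars R k).

Inductive lin_span (E : lmodType K) (G : set E) : set E :=
| lin_span0 : lin_span G 0
| lin_spanD (a : K) x y : G x -> lin_span G y -> lin_span G (a *: x + y).

Variables (E : lmodType K) (G : set E).

Lemma lin_span_sub x : G x -> lin_span G x.
Proof.
by move=> Gx; rewrite -[x]scale1r -[_ *: _]addr0; apply: lin_spanD => //; constructor.
Qed.

Lemma lin_span_add x y : lin_span G x -> lin_span G y -> lin_span G (x + y).
Proof.
elim=> [|a u v Gu _ IH] Gy; first by rewrite add0r.
by rewrite -addrA; apply: lin_spanD => //; apply: IH.
Qed.

Lemma lin_span_scale a x : lin_span G x -> lin_span G (a *: x).
Proof.
elim=> [|b u v Gu _ IH]; first by rewrite scaler0; constructor.
by rewrite scalerDr scalerA; apply: lin_spanD.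
Qed.

Lemma lin_span_opp x : lin_span G x -> lin_span G (- x).
Proof. by rewrite -scaleN1r; apply: lin_span_scale. Qed.

Lemma lin_span_ind0 (X : lmodType K) (f : E -> X) x :
  linear f -> (forall y, G y -> f y = 0) -> lin_span G x -> f x = 0.
Proof.
move=> fL fG; elim=> [|a u v Gu _ IH].
  by have := fL (-1) 0 0; rewrite !scaleN1r !addNr.
by rewrite fL fG// scaler0 add0r.
Qed.

End LinearSpan.

Section LinearBasics.
Context (K : numFieldType) (V W : lmodType K) (f : V -> W).
Hypothesis fL : linear f.
Lemma lin0 : f 0 = 0.
Proof. by have := fL (-1) 0 0; rewrite !scaleN1r !addNr. Qed.
Lemma linD x y : f (x + y) = f x + f y.
Proof. by rewrite -[x in LHS]scale1r fL scale1r. Qed.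
Lemma linZ a x : f (a *: x) = a *: f x.
Proof. by rewrite -[a *: x]addr0 fL lin0 addr0. Qed.
Lemma linN x : f (- x) = - f x.
Proof. by rewrite -scaleN1r linZ scaleN1r. Qed.
Lemma linB x y : f (x - y) = f x - f y.
Proof. by rewrite linD linN. Qed.
End LinearBasics.

Definition bilinear_map (K : numFieldType) (V W X : lmodType K)
    (f : V -> W -> X) : Prop :=
  (forall w, linear (f^~ w)) /\ (forall v, linear (f v)).

Section ProjectiveTensor.
Context (R : realType) (k : scalar_kind).
Local Notation K := (scalars R k).

Section Freeg.
Variables (T : choiceType) (X : lmodType K) (f : T -> X).
Lemma fglift_linear : linear (fglift f : {freeg T / K} -> X).
Proof.
have fD : {morph (fglift f : {freeg T / K} -> X) : x y / x + y}.
  have fB := @lift_is_additive K T X f.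
  have f0 : fglift f 0 = 0 by have := fB 0 0; rewrite !subrr.
  have fN x : fglift f (- x) = - fglift f x.
    by have := fB 0 x; rewrite !sub0r f0 sub0r.
  by move=> x y; rewrite -[y]opprK fB fN !opprK.
have f0 : fglift f 0 = 0.
  by apply: (addrI (fglift f 0)); rewrite -fD !addr0.
move=> a x y; rewrite fD; congr (_ + _).
have -> : a *: x = \sum_(t <- dom x) << (a * coeff t x) *g t >> by [].
rewrite -[x in RHS]freeg_sumE !(big_morph _ fD f0) scaler_sumr.
by apply: eq_bigr => t _; rewrite !liftU scalerA.
Qed.
End Freeg.

Variables (V W : completeNormedModType K).
Local Notation free := ({freeg (V * W)%type / K} : lmodType K).

Definition elementary (v : V) (w : W) : free := Freeg [:: (1, (v, w))].

Definition bilinear_relators : set free :=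
  [set x | (exists a v v' w,
             x = elementary (a *: v + v') w - (a *: elementary v w + elementary v' w)) \/
           (exists a v w w',
             x = elementary v (a *: w + w') - (a *: elementary v w + elementary v w'))].

(* The algebraic tensor product is the quotient of [free] by the span of
   [bilinear_relators]; the projective norm of (the class of) x is the infimum
   of the sums of |v||w| over the representations of x as a sum of pure
   tensors. *)
Definition projective_sums (x : free) : set R :=
  [set r | exists s : seq (V * W),
    lin_span bilinear_relators (x - \sum_(t <- s) elementary t.1 t.2) /\
    r = \sum_(t <- s) nrm t.1 * nrm t.2].

Let pureU a v w : (Freeg [:: (a, (v, w))] : free) = a *: elementary v w.
Proof.
by apply/eqP/freeg_eqP => z; rewrite coeffZ !coeffU mul1r.
Qed.

Let pure_scale a v w :
  lin_span bilinear_relators (a *: elementary v w - elementary (a *: v) w).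
Proof.
have rel b v1 v2 : lin_span bilinear_relators
    (elementary (b *: v1 + v2) w - (b *: elementary v1 w + elementary v2 w)).
  by apply: lin_span_sub; left; exists b, v1, v2, w.
have h0 : lin_span bilinear_relators (elementary 0 w).
  have := rel (-1) 0 0; rewrite scaleN1r addNr scaleN1r addNr subr0.
  exact.
have := lin_span_add (rel a v 0) h0.
by rewrite addr0 opprD addrA subrK => /lin_span_opp; rewrite opprB.
Qed.

Let sums0 x : projective_sums x !=set0.
Proof.
suff [s hs] : exists s : seq (V * W),
    lin_span bilinear_relators (x - \sum_(t <- s) elementary t.1 t.2).
  by exists (\sum_(t <- s) nrm t.1 * nrm t.2); exists s.
exists [seq (coeff z x *: z.1, z.2) | z <- dom x].
rewrite big_map -{1}[x]freeg_sumE.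
elim: (dom x) => [|[v w] s IH]; first by rewrite !big_nil subr0; constructor.
by rewrite !big_cons opprD addrACA pureU; apply: lin_span_add.
Qed.

Let sums_ge0 x r : projective_sums x r -> 0 <= r.
Proof.
by move=> [s [_ ->]]; apply: sumr_ge0 => t _; rewrite mulr_ge0 ?nrm_ge0.
Qed.

Let sumsD x y r s : projective_sums x r -> projective_sums y s ->
  projective_sums (x + y) (r + s).
Proof.
move=> [s1 [h1 ->]] [s2 [h2 ->]]; exists (s1 ++ s2); rewrite !big_cat; split => //.
by rewrite opprD addrACA; apply: lin_span_add.
Qed.

Let sumsZ (a : K) x r : projective_sums x r -> projective_sums (a *: x) (nrm a * r).
Proof.
move=> [s [h ->]]; exists [seq (a *: t.1, t.2) | t <- s]; rewrite !big_map; split.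
  have -> : a *: x - \sum_(t <- s) elementary (a *: t.1) t.2 =
     a *: (x - \sum_(t <- s) elementary t.1 t.2) +
     (a *: \sum_(t <- s) elementary t.1 t.2 - \sum_(t <- s) elementary (a *: t.1) t.2).
    by rewrite scalerBr addrA subrK.
  apply: lin_span_add; first exact: lin_span_scale.
  elim: s {h} => [|t s IH]; first by rewrite !big_nil scaler0 subr0; constructor.
  by rewrite !big_cons scalerDr opprD addrACA; apply: lin_span_add.
by rewrite mulr_sumr; apply: eq_bigr => t _; rewrite nrmZ mulrA.
Qed.

Definition projective_seminorm : seminorm free :=
  inf_seminorm sums0 sums_ge0 sumsD sumsZ.

Definition projective_tensor : completeNormedModType K :=
  completion projective_seminorm.

Definition tens (v : V) (w : W) : projective_tensor :=
  completion_in projective_seminorm (elementary v w).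

Let proj_rel x : lin_span bilinear_relators x -> projective_seminorm x = 0.
Proof.
move=> hx; apply/eqP; rewrite eq_le snorm_ge0 andbT; apply: inf_snorm_le => //.
by exists [::]; rewrite !big_nil subr0.
Qed.

Let rel_eq x y : bilinear_relators (x - y) ->
  completion_in projective_seminorm x = completion_in projective_seminorm y.
Proof.
move=> h; apply/eqP; rewrite -subr_eq0 -(linB (@completion_in_linear _ _ _ _)).
by apply/eqP/(@nrm_eq0 R k); rewrite completion_in_nrm proj_rel//; apply: lin_span_sub.
Qed.

Lemma tens_bilinear : bilinear_map tens.
Proof.
split=> [w a v v'|v a w w']; rewrite /tens -completion_in_linear; apply: rel_eq.
  by left; exists a, v, v', w.
by right; exists a, v, w, w'.
Qed.

Lemma nrm_tens v w : nrm (tens v w) <= nrm v * nrm w.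
Proof.
rewrite completion_in_nrm; apply: inf_snorm_le => //; exists [:: (v, w)].
by rewrite !big_seq1 subrr; split=> //; constructor.
Qed.

Lemma tens_lift (X : completeNormedModType K) (f : V -> W -> X) (C : R) :
  0 <= C -> bilinear_map f -> (forall v w, nrm (f v w) <= C * (nrm v * nrm w)) ->
  exists h : projective_tensor -> X,
    [/\ linear h, forall y, nrm (h y) <= C * nrm y &
        forall v w, h (tens v w) = f v w].
Proof.
move=> C0 [fl fr] fC.
pose g : free -> X := fglift (fun t => f t.1 t.2).
have gL : linear g by apply: fglift_linear.
have gp v w : g (elementary v w) = f v w by rewrite /g liftU scale1r.
have grel x : lin_span bilinear_relators x -> g x = 0.
  apply: lin_span_ind0 => // y [[a [v [v' [w ->]]]]|[a [v [w [w' ->]]]]].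
    by rewrite (linB gL) gL !gp fl subrr.
  by rewrite (linB gL) gL !gp fr subrr.
have gC x : nrm (g x) <= C * projective_seminorm x.
  have [C1|C1] := eqVneq C 0.
    have -> : g x = 0.
      rewrite -[x]freeg_sumE (big_morph g (linD gL) (lin0 gL)) big1// => -[v w] _.
      rewrite pureU (linZ gL) gp (_ : f v w = 0) ?scaler0//.
      apply: (@nrm_eq0 R k); apply/eqP; rewrite eq_le nrm_ge0 andbT.
      by rewrite (le_trans (fC _ _))// C1 mul0r.
    by rewrite nrm0 mulr_ge0 ?snorm_ge0.
  have {C1} Cp : 0 < C by rewrite lt_neqAle eq_sym C1.
  rewrite -ler_pdivrMl//; apply: inf_snorm_ge => // r [s [/grel hs ->]].
  move: hs; rewrite (linB gL) => /eqP; rewrite subr_eq0 => /eqP ->.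
  rewrite ler_pdivrMl// (big_morph g (linD gL) (lin0 gL)) mulr_sumr.
  elim: s => [|t s IH]; first by rewrite !big_nil nrm0.
  by rewrite !big_cons (le_trans (nrmD _ _))// lerD// gp fC.
have [h [hL hC hE]] := completion_lift C0 gL gC.
by exists h; split => // v w; rewrite hE gp.
Qed.

Lemma tens_ext (X : normedModType K) (h : projective_tensor -> X) (C : R) :
  linear h -> (forall y, nrm (h y) <= C * nrm y) ->
  (forall v w, h (tens v w) = 0) -> forall y, h y = 0.
Proof.
move=> hL hC h0 y.
have h1 x : h (completion_in projective_seminorm x) = 0.
  have cL := @completion_in_linear _ _ _ projective_seminorm.
  rewrite -[x]freeg_sumE (big_morph _ (linD cL) (lin0 cL)).
  rewrite (big_morph h (linD hL) (lin0 hL)) big1// => -[v w] _.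
  by rewrite pureU (linZ cL) (linZ hL) h0 scaler0.
apply: (@nrm_le0 R k) => e e0.
have C1 : 0 < `|C| + 1 by rewrite ltr_wpDl.
have [x hx] := completion_in_dense y (divr_gt0 e0 C1).
rewrite -[h y]subr0 -(h1 x) -(linB hL) (le_trans (hC _))//.
rewrite (le_trans (_ : _ <= (`|C| + 1) * nrm (y - completion_in projective_seminorm x)))//.
  by rewrite ler_wpM2r ?nrm_ge0// (le_trans (ler_norm C))// lerDl.
by rewrite mulrC -ler_pdivlMr// ltW.
Qed.

End ProjectiveTensor.

Section BanachQuotient.
Context (R : realType) (k : scalar_kind).
Local Notation K := (scalars R k).
Variables (V : completeNormedModType K) (G : set V).

(* The infimum of [coset_bounds x] is the distance from x to the span of G. It
   equals the distance to the closure of the span, and vanishes exactly on that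
   closure: [banach_quotient] is the quotient of V by the closed linear span of
   G, with the quotient norm. *)
Definition coset_bounds (x : V) : set R :=
  [set r | exists2 n, lin_span G n & nrm (x - n) <= r].

Let cb0 x : coset_bounds x !=set0.
Proof. by exists (nrm (x - 0)), 0 => //; constructor. Qed.
Let cb_ge0 x r : coset_bounds x r -> 0 <= r.
Proof. by move=> [n _]; apply: le_trans; apply: nrm_ge0. Qed.
Let cbD x y r s : coset_bounds x r -> coset_bounds y s ->
  coset_bounds (x + y) (r + s).
Proof.
move=> [n hn nr] [m hm ms]; exists (n + m); first exact: lin_span_add.
by rewrite opprD addrACA (le_trans (nrmD _ _))// lerD.
Qed.
Let cbZ (a : K) x r : coset_bounds x r -> coset_bounds (a *: x) (nrm a * r).
Proof.
move=> [n hn nr]; exists (a *: n); first exact: lin_span_scale.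
by rewrite -scalerBr nrmZ ler_wpM2l ?nrm_ge0.
Qed.

Definition quotient_seminorm : seminorm V := inf_seminorm cb0 cb_ge0 cbD cbZ.

Let qs_le x n : lin_span G n -> quotient_seminorm x <= nrm (x - n).
Proof. by move=> hn; apply: inf_snorm_le => //; exists n. Qed.

Let qs_lt x e : quotient_seminorm x < e ->
  exists2 n, lin_span G n & nrm (x - n) < e.
Proof.
move=> xe; have [r [n hn nr] re] : exists2 r, coset_bounds x r & r < e.
  by apply: inf_lt => //; split=> //; exists 0; apply: cb_ge0.
by exists n => //; apply: le_lt_trans re.
Qed.

Let pow2 n : 0 < 2^-1 ^+ n :> R. Proof. by rewrite exprn_gt0// invr_gt0. Qed.

Let qs_complete : seq_complete quotient_seminorm.
Proof.
move=> u uc.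
have /choice[N hN] : forall i, exists N, forall m n, (N <= m)%N -> (N <= n)%N ->
    quotient_seminorm (u m - u n) < 2^-1 ^+ i by move=> i; apply: uc.
pose M := fix M i := if i is j.+1 then maxn (M j) (N i) else N 0%N.
have MN i : (N i <= M i)%N by case: i => //= i; rewrite leq_maxr.
have MS i : (M i <= M i.+1)%N by rewrite /= leq_maxl.
have /choice[n hn] : forall i, exists n, lin_span G n /\
    nrm (u (M i.+1) - u (M i) - n) < 2^-1 ^+ i.
  move=> i; have [|n h1 h2] := @qs_lt (u (M i.+1) - u (M i)) (2^-1 ^+ i).
    by apply: hN; rewrite ?MN// (leq_trans (MN i)).
  by exists n.
pose v := fix v i := if i is j.+1 then v j + (u (M i) - u (M j) - n j) else u (M 0%N).
have vu i : quotient_seminorm (u (M i) - v i) = 0.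
  have [m hm ->] : exists2 m, lin_span G m & u (M i) - v i = m.
    elim: i => [|i [m hm IH]]; first by exists 0; [constructor|rewrite subrr].
    exists (m + n i); first by apply: lin_span_add => //; have [] := hn i.
    rewrite -IH [v i.+1]/=; apply/eqP; rewrite subr_eq -[_ - _ - n i]addrA -opprD.
    by rewrite addrA [_ + _ + v i]addrAC subrK subrKC.
  apply/eqP; rewrite eq_le snorm_ge0 andbT (le_trans (qs_le _ hm))//.
  by rewrite subrr nrm0.
have vS i j : nrm (v (i + j)%N - v i) <= 2 * 2^-1 ^+ i - 2 * 2^-1 ^+ (i + j).
  elim: j => [|j IH]; first by rewrite addn0 !subrr nrm0.
  rewrite addnS /= addrAC (le_trans (nrmD _ _))//.
  have [_ h] := hn (i + j)%N; have := lerD IH (ltW h) => /le_trans; apply.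
  have fin (a b : R) : 2 * a - 2 * b + b <= 2 * a - b by lra.
  by rewrite exprS mulrA divff ?pnatr_eq0// mul1r; apply: fin.
have half_lt (e : R) : 0 < e -> exists i, 2 * 2^-1 ^+ i < e.
  move=> e0; have e20 : 0 < e / 2 by rewrite divr_gt0.
  have [i hi] := inv_lt e20; exists i.
  have : (2^-1 ^+ i : R) <= i.+1%:R^-1.
    rewrite exprVn lef_pV2 ?posrE ?exprn_gt0 ?ltr0n//.
    by rewrite -natrX ler_nat ltn_expl.
  have fin (a b c : R) : b < c / 2 -> a <= b -> 2 * a < c by lra.
  exact/fin/hi.
have [l vl] : exists l, seq_lim (norm_seminorm V) v l.
  apply: banach_seq_complete => e e0.
  have e20 : 0 < e / 2 by rewrite divr_gt0.
  have [i hi] := half_lt _ e20.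
  have near m : (i <= m)%N -> nrm (v m - v i) < e / 2.
    move=> im; apply: le_lt_trans hi; rewrite -(subnKC im) (le_trans (vS _ _))//.
    by rewrite gerBl mulr_ge0// ltW.
  exists i => a b ia ib; have := snorm_tri (norm_seminorm V) (v i) (v a) (v b).
  move=> /le_lt_trans; apply; rewrite [e]splitr ltrD ?near//=.
  by rewrite nrmB near.
exists l => e e0; have e30 : 0 < e / 3 by rewrite divr_gt0.
have [i0 hi0] := half_lt _ e30; have [i1 hi1] := vl _ e30.
pose i := maxn i0 i1; exists (M i) => m Mm.
apply: (le_lt_trans (snorm_tri _ (u (M i)) _ _)).
have h1 : quotient_seminorm (u m - u (M i)) < e / 3.
  apply: (@lt_le_trans _ _ (2^-1 ^+ i)).
    by apply: hN => //; apply: leq_trans Mm.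
  have : (2^-1 ^+ i : R) <= 2^-1 ^+ i0.
    by apply: ler_wiXn2l; rewrite ?invr_ge0// ?invf_le1 ?ler1n// leq_maxl.
  by have := pow2 i0; lra.
have h2 : quotient_seminorm (u (M i) - l) < e / 3.
  apply: (le_lt_trans (snorm_tri _ (v i) _ _)); rewrite vu add0r.
  have /le_lt_trans : quotient_seminorm (v i - l) <= nrm (v i - l).
    by rewrite -[X in _ <= nrm X]subr0; apply: qs_le; constructor.
  by apply; apply: hi1; rewrite leq_maxr.
by have := ltrD h1 h2; lra.
Qed.

Definition banach_quotient : completeNormedModType K := hausdorff qs_complete.

Definition quotient_pi : V -> banach_quotient := hausdorff_pi qs_complete.

Lemma quotient_pi_linear : linear quotient_pi.
Proof. exact: hausdorff_pi_linear. Qed.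

Lemma nrm_quotient_pi x : nrm (quotient_pi x) <= nrm x.
Proof.
by rewrite hausdorff_pi_nrm -{2}[x]subr0; apply: qs_le; constructor.
Qed.

Lemma quotient_pi_surj y : exists x, quotient_pi x = y.
Proof. exact: hausdorff_pi_surj. Qed.

Lemma quotient_pi0 x : G x -> quotient_pi x = 0.
Proof.
move=> Gx; apply: (@nrm_eq0 R k); rewrite hausdorff_pi_nrm.
apply/eqP; rewrite eq_le snorm_ge0 andbT (le_trans (qs_le _ (lin_span_sub Gx)))//.
by rewrite subrr nrm0.
Qed.

Lemma quotient_pi_eq0 x :
  quotient_pi x = 0 <-> closure (lin_span G) x.
Proof.
split=> [x0|clx].
  move=> A /nbhs_ballP[e /= e0 eA].
  have re0 : 0 < reK e by rewrite -(ltr_toK k) toK0 reKK// ltW.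
  have [|n hn xn] := @qs_lt x (reK e).
    by have := hausdorff_pi_nrm qs_complete x; rewrite -/(quotient_pi x) x0 nrm0 => <-.
  exists n; split => //; apply: eA; rewrite -ball_normE /ball_/=.
  by rewrite -(reKK (ltW e0)) -toK_nrm ltr_toK.
apply: (@nrm_le0 R k) => e e0; rewrite hausdorff_pi_nrm.
have e0' : 0 < toK k e by rewrite -(toK0 R k) ltr_toK.
have [n [hn]] := clx _ (nbhsx_ballx x _ e0').
rewrite -ball_normE /ball_/= -toK_nrm ltr_toK => /ltW xn.
exact: le_trans (qs_le _ hn) xn.
Qed.

Lemma quotient_lift (X : normedModType K) (g : V -> X) (C : R) :
  0 <= C -> linear g -> (forall x, nrm (g x) <= C * nrm x) ->
  (forall x, G x -> g x = 0) ->
  exists h : banach_quotient -> X,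
    [/\ linear h, forall y, nrm (h y) <= C * nrm y &
        forall x, h (quotient_pi x) = g x].
Proof.
move=> C0 gL gC g0; apply: hausdorff_lift => // x.
have gN n : lin_span G n -> g n = 0 by apply: lin_span_ind0.
have h n : lin_span G n -> nrm (g x) <= C * nrm (x - n).
  by move=> hn; rewrite -[g x]subr0 -(gN n hn) -(linB gL) gC.
have [C1|C1] := eqVneq C 0.
  by rewrite (le_trans (gC x))// C1 !mul0r.
have {C1} Cp : 0 < C by rewrite lt_neqAle eq_sym C1.
rewrite -ler_pdivrMl//; apply: inf_snorm_ge => // r [n hn nr].
by rewrite ler_pdivrMl// (le_trans (h n hn))// ler_pM2l.
Qed.

End BanachQuotient.

Section Categories.

Record category := Category {
  ob :> Type;
  hom : ob -> ob -> Type;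
  idm : forall x, hom x x;
  compose : forall x y z, hom y z -> hom x y -> hom x z;
  compose_idl : forall x y (f : hom x y), compose (idm y) f = f;
  compose_idr : forall x y (f : hom x y), compose f (idm x) = f;
  composeA : forall x y z t (h : hom z t) (g : hom y z) (f : hom x y),
    compose h (compose g f) = compose (compose h g) f;
}.

Record functor (C D : category) := Functor {
  fob :> C -> D;
  fmap : forall x y : C, hom x y -> hom (fob x) (fob y);
  fmap_id : forall x : C, fmap (idm x) = idm (fob x);
  fmap_comp : forall (x y z : C) (g : hom y z) (f : hom x y),
    fmap (compose g f) = compose (fmap g) (fmap f);
}.

Definition id_functor (C : category) : functor C C :=
  @Functor C C (fun x => x) (fun x y f => f)
    (fun x => erefl) (fun x y z g f => erefl).

Definition comp_functor (C D E : category) (G : functor D E) (F : functor C D) :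
  functor C E.
Proof.
apply: (@Functor C E (fun x => G (F x)) (fun x y f => fmap G (fmap F f))).
- by move=> x; rewrite !fmap_id.
- by move=> x y z g f; rewrite !fmap_comp.
Defined.

Definition is_iso (C : category) (x y : C) (f : hom x y) : Prop :=
  exists g : hom y x, compose g f = idm x /\ compose f g = idm y.

Definition split_epi (C : category) (x y : C) (f : hom x y) : Prop :=
  exists s : hom y x, compose f s = idm y.

Definition naturally_isomorphic (C D : category) (F G : functor C D) : Prop :=
  exists t : forall x : C, hom (F x) (G x),
    (forall (x y : C) (f : hom x y), compose (fmap G f) (t x) = compose (t y) (fmap F f))
    /\ (forall x : C, is_iso (t x)).

Definition is_equivalence (C D : category) (F : functor C D) : Prop :=
  exists G : functor D C,
    naturally_isomorphic (comp_functor G F) (id_functor C) /\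
    naturally_isomorphic (comp_functor F G) (id_functor D).

Record adjunction (C D : category) (F : functor C D) (G : functor D C) :=
  Adjunction {
  adj_unit : forall x : C, hom x (G (F x));
  adj_counit : forall y : D, hom (F (G y)) y;
  adj_unit_nat : forall (x y : C) (f : hom x y),
    compose (fmap G (fmap F f)) (adj_unit x) = compose (adj_unit y) f;
  adj_counit_nat : forall (x y : D) (f : hom x y),
    compose f (adj_counit x) = compose (adj_counit y) (fmap F (fmap G f));
  triangle_l : forall x : C, compose (adj_counit (F x)) (fmap F (adj_unit x)) = idm (F x);
  triangle_r : forall y : D, compose (fmap G (adj_counit y)) (adj_unit (G y)) = idm (G y);
}.

Record comonad (D : category) := Comonad {
  cm_functor :> functor D D;
  cm_counit : forall x : D, hom (cm_functor x) x;
  cm_comult : forall x : D, hom (cm_functor x) (cm_functor (cm_functor x));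
  cm_counit_nat : forall (x y : D) (f : hom x y),
    compose f (cm_counit x) = compose (cm_counit y) (fmap cm_functor f);
  cm_comult_nat : forall (x y : D) (f : hom x y),
    compose (fmap cm_functor (fmap cm_functor f)) (cm_comult x) =
    compose (cm_comult y) (fmap cm_functor f);
  cm_counit_l : forall x : D,
    compose (cm_counit (cm_functor x)) (cm_comult x) = idm (cm_functor x);
  cm_counit_r : forall x : D,
    compose (fmap cm_functor (cm_counit x)) (cm_comult x) = idm (cm_functor x);
  cm_coassoc : forall x : D,
    compose (cm_comult (cm_functor x)) (cm_comult x) =
    compose (fmap cm_functor (cm_comult x)) (cm_comult x);
}.

Definition adjunction_comonad (C D : category) (F : functor C D)
    (G : functor D C) (adj : adjunction F G) : comonad D.
Proof.
apply: (@Comonad D (comp_functor F G) (adj_counit adj)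
          (fun x => fmap F (adj_unit adj (G x)))).
- by move=> x y f /=; rewrite adj_counit_nat.
- by move=> x y f /=; rewrite -!fmap_comp adj_unit_nat.
- by move=> x /=; rewrite triangle_l.
- by move=> x /=; rewrite -fmap_comp triangle_r fmap_id.
- by move=> x /=; rewrite -!fmap_comp adj_unit_nat.
Defined.

Record coalgebra (D : category) (T : comonad D) := Coalgebra {
  coalg_ob :> D;
  coalg_map : hom coalg_ob (T coalg_ob);
  coalg_counit : compose (cm_counit T coalg_ob) coalg_map = idm coalg_ob;
  coalg_coassoc : compose (cm_comult T coalg_ob) coalg_map =
                  compose (fmap T coalg_map) coalg_map;
}.

Record coalgebra_hom (D : category) (T : comonad D) (X Y : coalgebra T) :=
  CoalgebraHom {
  coalg_fun : hom (coalg_ob X) (coalg_ob Y);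
  coalg_funP : compose (coalg_map Y) coalg_fun = compose (fmap T coalg_fun) (coalg_map X);
}.

Lemma coalgebra_hom_ext (D : category) (T : comonad D) (X Y : coalgebra T)
  (f g : coalgebra_hom X Y) : coalg_fun f = coalg_fun g -> f = g.
Proof.
by case: f g => [f fP] [g gP] /= h; subst g; congr CoalgebraHom; apply: Prop_irrelevance.
Qed.

Section CoalgebraCategory.
Variables (D : category) (T : comonad D).

Definition coalgebra_id (X : coalgebra T) : coalgebra_hom X X.
Proof.
by exists (idm (coalg_ob X)); rewrite fmap_id compose_idl compose_idr.
Defined.

Definition coalgebra_comp (X Y Z : coalgebra T) (g : coalgebra_hom Y Z)
  (f : coalgebra_hom X Y) : coalgebra_hom X Z.
Proof.
exists (compose (coalg_fun g) (coalg_fun f)).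
by rewrite composeA coalg_funP -composeA coalg_funP composeA -fmap_comp.
Defined.

Definition coalgebra_category : category.
Proof.
apply: (@Category (coalgebra T) (@coalgebra_hom D T)
          coalgebra_id coalgebra_comp).
- by move=> X Y f; apply: coalgebra_hom_ext; rewrite /= compose_idl.
- by move=> X Y f; apply: coalgebra_hom_ext; rewrite /= compose_idr.
- by move=> X Y Z W h g f; apply: coalgebra_hom_ext; rewrite /= composeA.
Defined.

End CoalgebraCategory.

Section Comparison.
Variables (C D : category) (F : functor C D) (G : functor D C).
Variable adj : adjunction F G.
Local Notation T := (adjunction_comonad adj).

Definition comparison_ob (x : C) : coalgebra T.
Proof.
apply: (@Coalgebra D T (F x) (fmap F (adj_unit adj x))).
- exact: triangle_l.
- by rewrite /= -!fmap_comp adj_unit_nat.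
Defined.

Definition comparison_hom (x y : C) (f : hom x y) :
  coalgebra_hom (comparison_ob x) (comparison_ob y).
Proof.
apply: (@CoalgebraHom D T (comparison_ob x) (comparison_ob y) (fmap F f)).
by rewrite /= -!fmap_comp adj_unit_nat.
Defined.

Definition comparison_functor : functor C (coalgebra_category T).
Proof.
apply: (@Functor C (coalgebra_category T) comparison_ob comparison_hom).
- by move=> x; apply: coalgebra_hom_ext; rewrite /= fmap_id.
- by move=> x y z g f; apply: coalgebra_hom_ext; rewrite /= fmap_comp.
Defined.

End Comparison.

(* [adj] exhibits F as a functor with a right adjoint. *)
Definition comonadic (C D : category) (F : functor C D) (G : functor D C)
    (adj : adjunction F G) : Prop := is_equivalence (comparison_functor adj).

End Categories.

Opaque hausdorff completion projective_tensor tens banach_quotient quotient_pi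
  internal_hom ihom_fun mk_ihom.

(* Unital Banach algebras, i.e. monoids in the category of Banach spaces and
   linear contractions; the zero algebra is allowed. *)
Record banach_algebra (K : numFieldType) := BanachAlgebra {
  balg_space :> completeNormedModType K;
  bmul : balg_space -> balg_space -> balg_space;
  bone : balg_space;
  bmul_bilinear : bilinear_map bmul;
  bmulA : associative bmul;
  bmul1b : left_id bone bmul;
  bmulb1 : right_id bone bmul;
  bmul_norm : forall x y, `|bmul x y| <= `|x| * `|y|;
  bone_norm : `|bone| <= 1;
}.

Record com_banach_algebra (K : numFieldType) := ComBanachAlgebra {
  com_balg :> banach_algebra K;
  bmulC : commutative (@bmul K com_balg);
}.

Local Notation "x ** y" := (bmul x y) (at level 40, left associativity).

Record banach_algebra_hom (K : numFieldType) (A B : banach_algebra K) :=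
  BanachAlgebraHom {
  bah_fun :> A -> B;
  bah_linear : linear bah_fun;
  bahM : forall x y, bah_fun (x ** y) = bah_fun x ** bah_fun y;
  bah1 : bah_fun (bone A) = bone B;
  bah_norm : forall x, `|bah_fun x| <= `|x|;
}.

Definition central_hom (K : numFieldType) (A B : banach_algebra K)
    (i : banach_algebra_hom A B) : Prop :=
  forall a b, i a ** b = b ** i a.

Record banach_module (K : numFieldType) (A : banach_algebra K) := BanachModule {
  bmod_space :> completeNormedModType K;
  act : A -> bmod_space -> bmod_space;
  act_bilinear : bilinear_map act;
  act1 : forall v, act (bone A) v = v;
  actM : forall a b v, act (a ** b) v = act a (act b v);
  act_norm : forall a v, `|act a v| <= `|a| * `|v|;
}.

Record module_hom (K : numFieldType) (A : banach_algebra K)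
    (V W : banach_module A) := ModuleHom {
  mh_fun :> V -> W;
  mh_linear : linear mh_fun;
  mh_act : forall a v, mh_fun (act a v) = act a (mh_fun v);
  mh_contraction : forall v, `|mh_fun v| <= `|v|;
}.

Section ModuleCategory.
Variables (K : numFieldType) (A : banach_algebra K).

Lemma module_hom_ext (V W : banach_module A) (f g : module_hom V W) :
  (forall v, f v = g v) -> f = g.
Proof.
case: f g => [f f1 f2 f3] [g g1 g2 g3] /= /funext h; subst g.
by congr ModuleHom; apply: Prop_irrelevance.
Qed.

Definition module_id (V : banach_module A) : module_hom V V.
Proof. by apply: (@ModuleHom K A V V (fun v => v)). Defined.

Definition module_comp (U V W : banach_module A) (g : module_hom V W)
  (f : module_hom U V) : module_hom U W.
Proof.
apply: (@ModuleHom K A U W (fun u => g (f u))).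
- by move=> a x y; rewrite !mh_linear.
- by move=> a v; rewrite !mh_act.
- by move=> v; apply: le_trans (mh_contraction f v); apply: mh_contraction.
Defined.

Definition module_category : category.
Proof.
apply: (@Category (banach_module A) (@module_hom K A) module_id module_comp);
by move=> *; apply: module_hom_ext.
Defined.

Definition regular_module : banach_module A.
Proof.
apply: (@BanachModule K A A (@bmul K A)).
- exact: bmul_bilinear.
- exact: bmul1b.
- by move=> a b c; rewrite bmulA.
- exact: bmul_norm.
Defined.

End ModuleCategory.

Section Restriction.
Variables (K : numFieldType) (A B : banach_algebra K).
Variable i : banach_algebra_hom A B.

Definition restrict (N : banach_module B) : banach_module A.
Proof.
apply: (@BanachModule K A N (fun a n => act (i a) n)).
- have [bl br] := act_bilinear N; split=> [n a x y|a c x y].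
    by rewrite bah_linear bl.
  exact: br.
- by move=> n; rewrite bah1 act1.
- by move=> a b n; rewrite bahM actM.
- move=> a n; rewrite (le_trans (act_norm _ _))//.
  by rewrite ler_wpM2r// bah_norm.
Defined.

Definition restrict_hom (M N : banach_module B) (f : module_hom M N) :
  module_hom (restrict M) (restrict N).
Proof.
apply: (@ModuleHom K A (restrict M) (restrict N) f).
- exact: (mh_linear f).
- by move=> a v; apply: (mh_act f).
- exact: (mh_contraction f).
Defined.

Definition restriction : functor (module_category B) (module_category A).
Proof.
by apply: (@Functor (module_category B) (module_category A) restrict restrict_hom);
  move=> *; apply: module_hom_ext.
Defined.

(* i itself, as a morphism of A-modules. *)
Definition algebra_map :
  module_hom (regular_module A) (restrict (regular_module B)).
Proof.
apply: (@ModuleHom K A (regular_module A) (restrict (regular_module B)) i).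
- exact: (bah_linear i).
- by move=> a b; apply: (bahM i).
- exact: (bah_norm i).
Defined.

End Restriction.

Section Extension.
Context (R : realType) (k : scalar_kind).
Local Notation K := (scalars R k).
Variables (A B : banach_algebra K) (i : banach_algebra_hom A B).

Section ExtensionOb.
Variable V : banach_module A.

Definition balancing_relators : set (projective_tensor B V) :=
  [set x | exists b a v, x = tens (b ** i a) (v : V) - tens b (act a v)].

Definition ext_space : completeNormedModType K := banach_quotient balancing_relators.

Definition ext_tens (b : B) (v : V) : ext_space :=
  quotient_pi balancing_relators (tens b v).

Lemma ext_tens_bilinear : bilinear_map ext_tens.
Proof.
have [bl br] := @tens_bilinear R k B V.
by split=> [v a b c|b a v w]; rewrite /ext_tens ?bl ?br quotient_pi_linear.
Qed.

Lemma ext_tens_balanced b a v : ext_tens (b ** i a) v = ext_tens b (act a v).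
Proof.
apply/eqP; rewrite -subr_eq0 -(linB (@quotient_pi_linear _ _ _ _)).
by rewrite quotient_pi0//; exists b, a, v.
Qed.

Lemma nrm_ext_tens b v : nrm (ext_tens b v) <= nrm b * nrm v.
Proof. exact: le_trans (nrm_quotient_pi _ _) (nrm_tens _ _). Qed.

Lemma ext_lift (X : completeNormedModType K) (f : B -> V -> X) (C : R) :
  0 <= C -> bilinear_map f -> (forall b a v, f (b ** i a) v = f b (act a v)) ->
  (forall b v, nrm (f b v) <= C * (nrm b * nrm v)) ->
  exists h : ext_space -> X,
    [/\ linear h, forall t, nrm (h t) <= C * nrm t &
        forall b v, h (ext_tens b v) = f b v].
Proof.
move=> C0 fbil fbal fC; have [g [gL gC gE]] := tens_lift C0 fbil fC.
have [|h [hL hC hE]] := @quotient_lift R k _ balancing_relators X g C C0 gL gC.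
  by move=> _ [b [a [v ->]]]; rewrite (linB gL) !gE fbal subrr.
by exists h; split => // b v; rewrite hE gE.
Qed.

Lemma ext_eq (X : normedModType K) (g h : ext_space -> X) (C D : R) :
  linear g -> (forall t, nrm (g t) <= C * nrm t) ->
  linear h -> (forall t, nrm (h t) <= D * nrm t) ->
  (forall b v, g (ext_tens b v) = h (ext_tens b v)) -> forall t, g t = h t.
Proof.
move=> gL gC hL hD gh t; have [x <-] := quotient_pi_surj t.
have pL := @quotient_pi_linear _ _ _ balancing_relators.
apply/eqP; rewrite -subr_eq0; apply/eqP.
apply: (@tens_ext R k B V X
  (fun x => g (quotient_pi _ x) - h (quotient_pi _ x)) (`|C| + `|D|)).
- move=> a u v; rewrite pL gL hL scalerBr opprD addrACA.
  by [].
- move=> y; rewrite (le_trans (nrmD _ _))// nrmN mulrDl lerD//.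
    rewrite (le_trans (gC _))// (le_trans (ler_wpM2r (nrm_ge0 _) (ler_norm C)))//.
    by rewrite ler_wpM2l// nrm_quotient_pi.
  rewrite (le_trans (hD _))// (le_trans (ler_wpM2r (nrm_ge0 _) (ler_norm D)))//.
  by rewrite ler_wpM2l// nrm_quotient_pi.
- by move=> b v; rewrite [X in X - _]gh subrr.
Qed.

Lemma ext_act_exists (b : B) : exists h : ext_space -> ext_space,
  [/\ linear h, forall t, nrm (h t) <= nrm b * nrm t &
      forall c v, h (ext_tens c v) = ext_tens (b ** c) v].
Proof.
have [el er] := ext_tens_bilinear.
apply: (@ext_lift _ (fun c v => ext_tens (b ** c) v)); first exact: nrm_ge0.
- split=> [v a x y|c a x y]; last exact: er.
  by have [_ mr] := bmul_bilinear B; rewrite mr el.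
- by move=> c a v; rewrite bmulA ext_tens_balanced.
- move=> c v; rewrite (le_trans (nrm_ext_tens _ _))// mulrA.
  by rewrite ler_wpM2r ?nrm_ge0// -(ler_toK k) toKM !toK_nrm bmul_norm.
Qed.

(* The unique bounded linear map with b (c (x) v) = bc (x) v. *)
Definition ext_act (b : B) : ext_space -> ext_space :=
  projT1 (cid (ext_act_exists b)).

Lemma ext_act_linear b : linear (ext_act b).
Proof. by rewrite /ext_act; case: cid => h []. Qed.
Lemma nrm_ext_act b t : nrm (ext_act b t) <= nrm b * nrm t.
Proof. by rewrite /ext_act; case: cid => h []. Qed.
Lemma ext_actE b c v : ext_act b (ext_tens c v) = ext_tens (b ** c) v.
Proof. by rewrite /ext_act; case: cid => h []. Qed.

Opaque ext_act.

Definition extend : banach_module B.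
Proof.
apply: (@BanachModule K B ext_space ext_act).
- have [el er] := ext_tens_bilinear; split=> [t a b c|b]; last exact: ext_act_linear.
  apply: (@ext_eq _ (ext_act (a *: b + c))
    (fun t => a *: ext_act b t + ext_act c t) _ (nrm a * nrm b + nrm c)).
  + exact: ext_act_linear.
  + exact: nrm_ext_act.
  + move=> d x y; rewrite !ext_act_linear !scalerDr !scalerA [d * a]mulrC.
    by rewrite -!addrA; congr (_ + _); rewrite addrCA.
  + move=> x; apply: le_trans (nrmD _ _) _; rewrite mulrDl.
    apply: lerD; last exact: nrm_ext_act.
    rewrite nrmZ -mulrA; apply: ler_wpM2l; first exact: nrm_ge0.
    exact: nrm_ext_act.
  + by move=> x v; have [ml _] := bmul_bilinear B; rewrite !ext_actE ml el.
- apply: (@ext_eq _ (ext_act (bone B)) (fun t => t) (nrm (bone B)) 1) => //.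
  + exact: ext_act_linear.
  + exact: nrm_ext_act.
  + by move=> t; rewrite mul1r.
  + by move=> c v; rewrite ext_actE bmul1b.
- move=> b c; apply: (@ext_eq _ (ext_act (b ** c))
    (fun t => ext_act b (ext_act c t)) (nrm (b ** c)) (nrm b * nrm c)).
  + exact: ext_act_linear.
  + exact: nrm_ext_act.
  + by move=> a x y; rewrite !ext_act_linear.
  + move=> t; apply: le_trans (nrm_ext_act _ _) _; rewrite -mulrA.
    by apply: ler_wpM2l; [exact: nrm_ge0|exact: nrm_ext_act].
  + by move=> d v; rewrite !ext_actE bmulA.
- by move=> b t; rewrite -!toK_nrm -toKM ler_toK nrm_ext_act.
Defined.

End ExtensionOb.

Lemma module_hom_nrm (C : banach_algebra K) (V W : banach_module C)
  (f : module_hom V W) v : nrm (f v) <= 1 * nrm v.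
Proof. by rewrite mul1r ler_nrm mh_contraction. Qed.

(* A bounded linear map out of B (x)_A V into a B-module is B-linear as soon as
   it is on the elementary tensors. *)
Lemma ext_linear_act (V : banach_module A) (N : banach_module B)
    (h : extend V -> N) (C : R) :
  linear h -> (forall t, nrm (h t) <= C * nrm t) ->
  (forall b c (v : V), h (ext_tens (b ** c) v) = act b (h (ext_tens c v))) ->
  forall b t, h (act b t) = act b (h t).
Proof.
move=> hL hC hE b; have actL M (c : B) : linear (@act K B (M) c) by have [] := act_bilinear M.
have actC (M : banach_module B) (c : B) (m : M) : nrm (act c m) <= nrm c * nrm m.
  by rewrite -(ler_toK k) toKM !toK_nrm act_norm.
have hC' t : nrm (h t) <= `|C| * nrm t.
  by rewrite (le_trans (hC t))// ler_wpM2r ?nrm_ge0// ler_norm.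
refine (@ext_eq V N (fun t : extend V => h (act b t)) (fun t => act b (h t))
  (`|C| * nrm b) (nrm b * `|C|) _ _ _ _ _).
- by move=> a x y; rewrite actL hL.
- move=> t; apply: le_trans (hC' _) _; rewrite -mulrA.
  by apply: ler_wpM2l; [exact: normr_ge0|exact: actC].
- by move=> a x y; rewrite hL actL.
- move=> t; apply: le_trans (actC _ _ _) _; rewrite -mulrA.
  by apply: ler_wpM2l; [exact: nrm_ge0|exact: hC'].
- by move=> c v; rewrite -hE /= ext_actE.
Qed.

Lemma extend_hom_exists (V W : banach_module A) (f : module_hom V W) :
  exists h : module_hom (extend V) (extend W),
    forall b (v : V), h (ext_tens b v) = ext_tens b (f v).
Proof.
have [el er] := ext_tens_bilinear W.
have [||||h [hL hC hE]] := @ext_lift V (ext_space W) (fun b v => ext_tens b (f v)) 1.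
- by [].
- by split=> [v a b c|b a v w]; [exact: el|rewrite mh_linear er].
- by move=> b a v; rewrite ext_tens_balanced mh_act.
- move=> b v; rewrite mul1r (le_trans (nrm_ext_tens _ _))// ler_wpM2l ?nrm_ge0//.
  by rewrite ler_nrm mh_contraction.
have hB : forall b t, h (@act K B (extend V) b t) = @act K B (extend W) b (h t).
  by apply: (@ext_linear_act V (extend W) h 1) => // b c v; rewrite !hE /= ext_actE.
have h1 (t : extend V) : `|h t : extend W| <= `|t|.
  by have := hC t; rewrite mul1r ler_nrm.
by exists (@ModuleHom K B (extend V) (extend W) h hL hB h1).
Qed.

(* The unique morphism with b (x) v |-> b (x) f v. *)
Definition extend_hom (V W : banach_module A) (f : module_hom V W) :
  module_hom (extend V) (extend W) := projT1 (cid (extend_hom_exists f)).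

Lemma extend_homE (V W : banach_module A) (f : module_hom V W) b (v : V) :
  extend_hom f (ext_tens b v) = ext_tens b (f v).
Proof. by rewrite /extend_hom; case: cid. Qed.

Lemma extend_hom_eq (V : banach_module A) (N : banach_module B)
    (g h : module_hom (extend V) N) :
  (forall b (v : V), g (ext_tens b v) = h (ext_tens b v)) -> g = h.
Proof.
move=> gh; apply: module_hom_ext.
exact: (@ext_eq V N g h 1 1 (mh_linear g) (@module_hom_nrm B (extend V) N g)
  (mh_linear h) (@module_hom_nrm B (extend V) N h) gh).
Qed.

Definition extension : functor (module_category A) (module_category B).
Proof.
apply: (@Functor (module_category A) (module_category B) extend extend_hom).
- by move=> V; apply: extend_hom_eq => b v; rewrite extend_homE.
- by move=> U V W g f; apply: extend_hom_eq => b v; rewrite /= !extend_homE.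
Defined.

(* V = A (x)_A V -> B (x)_A V *)
Definition extension_unit (V : banach_module A) :
  module_hom V (restrict i (extend V)).
Proof.
apply: (@ModuleHom K A V (restrict i (extend V)) (fun v => ext_tens (bone B) v)).
- by have [_ er] := ext_tens_bilinear V; exact: er.
- by move=> a v; rewrite /= ext_actE -ext_tens_balanced bmul1b bmulb1.
- move=> v; rewrite -ler_nrm (le_trans (nrm_ext_tens _ _))//.
  rewrite ler_piMl ?nrm_ge0// -(ler_toK k) toK_nrm toK1.
  exact: bone_norm.
Defined.

Lemma extension_counit_exists (N : banach_module B) :
  exists h : module_hom (extend (restrict i N)) N,
    forall b (n : N), h (ext_tens (V := restrict i N) b n) = act b n.
Proof.
have [bl br] := act_bilinear N.
have [||||h [hL hC hE]] := @ext_lift (restrict i N) N (fun b n => act b n) 1.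
- by [].
- by [].
- by move=> b a v; rewrite actM.
- by move=> b v; rewrite mul1r -(ler_toK k) toKM !toK_nrm act_norm.
have hB : forall b t, h (@act K B (extend (restrict i N)) b t) = act b (h t).
  by apply: (@ext_linear_act _ N h 1) => // b c v; rewrite !hE actM.
have h1 (t : extend (restrict i N)) : `|h t| <= `|t|.
  by have := hC t; rewrite mul1r ler_nrm.
by exists (@ModuleHom K B (extend (restrict i N)) N h hL hB h1).
Qed.

(* The unique morphism with b (x) n |-> b n. *)
Definition extension_counit (N : banach_module B) :
  module_hom (extend (restrict i N)) N := projT1 (cid (extension_counit_exists N)).

Lemma extension_counitE (N : banach_module B) b (n : N) :
  extension_counit N (ext_tens (V := restrict i N) b n) = act b n.
Proof. by rewrite /extension_counit; case: cid. Qed.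

Definition extension_adjunction : adjunction extension (restriction i).
Proof.
apply: (@Adjunction (module_category A) (module_category B) extension
          (restriction i) extension_unit extension_counit).
- by move=> V W f; apply: module_hom_ext => v; rewrite /= extend_homE.
- move=> M N f; apply: extend_hom_eq => b m.
  by rewrite /= extend_homE !extension_counitE mh_act.
- move=> V; apply: extend_hom_eq => b v.
  by rewrite /= extend_homE extension_counitE /= ext_actE bmulb1.
- by move=> N; apply: module_hom_ext => n; rewrite /= extension_counitE act1.
Defined.

Definition effective_descent : Prop := comonadic extension_adjunction.

Definition isometric_inclusion (V W : normedModType K) (f : V -> W) : Prop :=
  linear f /\ forall v, `|f v| = `|v|.

Definition tensor_pure : Prop :=
  forall V : banach_module A, isometric_inclusion (extension_unit V).

End Extension.

Section Dual.
Context (R : realType) (k : scalar_kind).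
Local Notation K := (scalars R k).
Variable A : com_banach_algebra K.
Implicit Types V W : banach_module A.

Definition dual_space V : completeNormedModType K :=
  internal_hom V (scalar_space R k).

Lemma dual_act_linear V (a : A) (f : dual_space V) :
  linear (fun v : V => ihom_fun f (act a v)).
Proof.
have [_ aL] := act_bilinear V.
by move=> c x y; rewrite aL ihom_linear.
Qed.

Lemma dual_act_bound V (a : A) (f : dual_space V) (v : V) :
  nrm (ihom_fun f (act a v)) <= nrm f * nrm a * nrm v.
Proof.
rewrite -(ler_toK k) !toKM !toK_nrm (le_trans (ihom_bound _ _))// -mulrA.
by rewrite ler_wpM2l// act_norm.
Qed.

Definition dual_act V (a : A) (f : dual_space V) : dual_space V :=
  mk_ihom (dual_act_linear a f) (dual_act_bound a f).

Lemma dual_actE V (a : A) (f : dual_space V) v :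
  ihom_fun (dual_act a f) v = ihom_fun f (act a v).
Proof. exact: mk_ihomE. Qed.

Definition dual_module V : banach_module A.
Proof.
apply: (@BanachModule K A (dual_space V) (@dual_act V)).
- have [al ar] := act_bilinear V; split=> [f a b c|a b f g].
    by apply: ihom_ext => v; rewrite ihom_lin !dual_actE al ihom_linear.
  by apply: ihom_ext => v; rewrite ihom_lin !dual_actE ihom_lin.
- by move=> f; apply: ihom_ext => v; rewrite dual_actE act1.
- by move=> a b f; apply: ihom_ext => v; rewrite !dual_actE bmulC actM.
- move=> a f; rewrite -!toK_nrm -toKM ler_toK mulrC.
  by apply: ihom_norm_le; [rewrite mulr_ge0 ?nrm_ge0|move=> v; rewrite dual_actE dual_act_bound].
Defined.

Section DualMap.
Variables (V W : banach_module A) (f : module_hom V W).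

Lemma dual_map_linear (g : dual_space W) : linear (fun v => ihom_fun g (f v)).
Proof. by move=> c x y; rewrite mh_linear ihom_linear. Qed.

Lemma dual_map_bound (g : dual_space W) (v : V) :
  nrm (ihom_fun g (f v)) <= nrm g * nrm v.
Proof.
rewrite -(ler_toK k) toKM !toK_nrm (le_trans (ihom_bound _ _))//.
by rewrite ler_wpM2l// mh_contraction.
Qed.

Definition dual_map : module_hom (dual_module W) (dual_module V).
Proof.
apply: (@ModuleHom K A (dual_module W) (dual_module V)
          (fun g => mk_ihom (dual_map_linear g) (dual_map_bound g))).
- by move=> c g h; apply: ihom_ext => v; rewrite ihom_lin !mk_ihomE ihom_lin.
- by move=> a g; apply: ihom_ext => v; rewrite !(dual_actE, mk_ihomE) mh_act.
- move=> g; rewrite -ler_nrm; apply: ihom_norm_le; first exact: nrm_ge0.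
  by move=> v; rewrite mk_ihomE; apply: dual_map_bound.
Defined.

Definition weak_retract : Prop :=
  split_epi (C := module_category A) (x := dual_module W) (y := dual_module V)
    dual_map.

End DualMap.
End Dual.

(* Main.v *)
(* A left inverse s of the dual map of i yields, naturally in V, a left inverse
   [sigma] of the dual of the unit eta : V -> B (x)_A V, namely
   sigma(phi)(b (x) v) = s(a |-> phi(a v))(b); with Hahn-Banach this makes eta
   isometric.  Conversely, if eta is isometric for V = A^*, then evaluation at 1
   extends along eta to a functional h of norm at most 1, and
   s(f)(b) = h(b (x) f) splits the dual map of i.

   For a coalgebra (N, theta) put X = N viewed over A, Y = B (x)_A X and
   T = theta - eta : X -> Y.  After dualizing, (theta^*, eta^*, sigma) is a
   contractible pair, so every functional in the range of T^* is T^*h with h no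
   larger than it.  The quantitative closed range theorem then shows that T is
   open onto its range; hence V = ker T has annihilator exactly the range of T^*,
   and V -> X is itself a weak retract.  As (B (x)_A V)^* = Hom_A(B, V^* ), weak
   retracts stay isometric after extension of scalars, and B (x)_A V is
   identified with the image of theta, that is, with N.  Full faithfulness of the
   comparison functor is the same argument for the cofree pair of V.

   Conversely, if the comparison functor is fully faithful, then eta is, up to an
   isometric isomorphism, the inclusion of the equalizer of the two maps
   B (x)_A V -> B (x)_A B (x)_A V. *)
Require Import Defs.
From HB Require Import structures.
From mathcomp Require Import all_boot all_order all_algebra reals.
From mathcomp Require Import all_classical topology normedtype complex lra ring.
(* Imported again because the libraries above shadow [extend] and [restrict]. *)
Import Defs.
Set Implicit Arguments.
Unset Strict Implicit.
Unset Printing Implicit Defensive.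
Import Order.TTheory GRing.Theory Num.Theory.
Import numFieldNormedType.Exports.
Local Open Scope classical_set_scope.
Local Open Scope ring_scope.
Local Notation "x ** y" := (bmul x y) (at level 40, left associativity).

(** * The Hahn-Banach theorem *)
Section RealHahnBanach.
Context (R : realType) (k : scalar_kind) (E : lmodType (scalars R k)) (p : seminorm E).

(* Partial linear functionals are represented by their graphs: a real-linear
   relation lying below p is automatically single-valued. *)
Definition dominated_graph (G : set (E * R)) : Prop :=
  (forall a x y, G x -> G y -> G (toK k a *: x.1 + y.1, a * x.2 + y.2)) /\
  (forall x, G x -> x.2 <= p x.1).

Lemma toKN (r : R) : toK k (- r) = - toK k r.
Proof. by apply/eqP; rewrite -addr_eq0 -toKD addNr toK0. Qed.

Lemma snorm_toKZ (r : R) x : 0 <= r -> p (toK k r *: x) = r * p x.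
Proof.
move=> r0; rewrite snormZ /nrm ger0_norm ?toKK//.
by rewrite -(toK0 R k) ler_toK.
Qed.

Lemma dominated_graphZ G a x : dominated_graph G -> G x -> G (toK k a *: x.1, a * x.2).
Proof.
(* [G] is not known to contain 0, so the multiple by [a] is reached as [(a - 1) x + x]. *)
move=> [GL _] Gx; have := GL (a - 1) _ _ Gx Gx.
by rewrite toKD toKN toK1 scalerBl scale1r subrK mulrBl mul1r subrK.
Qed.

(** The difference of two pairs above [x] is a pair [(0, a - b)] of the graph, and it lies below
    [p 0 = 0]. *)
Lemma dominated_graph_fun G x r s : dominated_graph G -> G (x, r) -> G (x, s) -> r = s.
Proof.
move=> GG; have le a b : G (x, a) -> G (x, b) -> a <= b.
  move=> Ga Gb; have [GL GP] := GG.
  have := GP _ (GL (-1) _ _ Gb Ga).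
  rewrite /= toKN toK1 scaleN1r addNr snorm0 mulN1r addrC subr_le0.
  exact.
by move=> hr hs; apply/eqP; rewrite eq_le !le.
Qed.

(** The value at [x0] has to lie between all [y.2 - p (y.1 - x0)] and all [p (w.1 + x0) - w.2]; the
    supremum of the former is taken. If [x0] is in the domain already, domination of [H] forces the
    old value. *)
Lemma dominated_graph_extend G x0 : dominated_graph G -> G !=set0 ->
  exists2 H, dominated_graph H & G `<=` H /\ exists r, H (x0, r).
Proof.
move=> GG [z Gz]; have [GL GP] := GG.
pose S := [set y.2 - p (y.1 - x0) | y in G].
have Sle a : (forall y, G y -> y.2 - p (y.1 - x0) <= a) -> sup S <= a.
  move=> h; apply: ge_sup; first by exists (z.2 - p (z.1 - x0)), z.
  by move=> _ [y Gy <-]; apply: h.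
have cross y w : G y -> G w -> y.2 - p (y.1 - x0) <= p (w.1 + x0) - w.2.
  move=> Gy Gw; rewrite lerBrDr addrAC lerBlDr.
  have := GP _ (GL 1 _ _ Gy Gw); rewrite toK1 scale1r mul1r /= => /le_trans -> //.
  by rewrite -[y.1 + w.1](subrKA x0) addrC [x0 + _]addrC snormD.
have hi w : G w -> sup S <= p (w.1 + x0) - w.2.
  by move=> Gw; apply: Sle => y Gy; apply: cross.
have lo y : G y -> y.2 - p (y.1 - x0) <= sup S.
  move=> Gy; apply: ub_le_sup; last by exists y.
  by exists (p (z.1 + x0) - z.2) => _ [w Gw <-]; apply: cross.
pose H := [set w : E * R | exists y t, G y /\ w = (y.1 + toK k t *: x0, y.2 + t * sup S)].
exists H; first split.
- move=> a _ _ [y [t [Gy ->]]] [w [u [Gw ->]]].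
  exists (toK k a *: y.1 + w.1, a * y.2 + w.2), (a * t + u); split; first exact: GL.
  congr (_, _) => /=; last by lra.
  by rewrite scalerDr scalerA -toKM toKD scalerDl addrACA.
- move=> _ [y [t [Gy ->]]] /=.
  (* Dividing by [|t|] reduces the bound to [lo] for negative [t] and to [hi] for positive [t]. *)
  have [t0|t0|->] := ltrgt0P t; last first.
  + by rewrite toK0 scale0r mul0r !addr0 GP.
  + have nt0 : 0 < - t by rewrite oppr_gt0.
    have /lo/= := dominated_graphZ ((- t)^-1) GG Gy.
    rewrite -(ler_pM2l nt0) mulrBr mulrA divff ?gt_eqF// mul1r -(snorm_toKZ _ (ltW nt0)).
    rewrite scalerBr scalerA -toKM divff ?gt_eqF// toK1 scale1r toKN scaleNr opprK.
    by lra.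
  + have /hi/= := dominated_graphZ (t^-1) GG Gy.
    rewrite -(ler_pM2l t0) mulrBr mulrA divff ?gt_eqF// mul1r -(snorm_toKZ _ (ltW t0)).
    rewrite scalerDr scalerA -toKM divff ?gt_eqF// toK1 scale1r.
    by lra.
- split.
    move=> y Gy; exists y, 0; split=> //; rewrite toK0 scale0r mul0r !addr0.
    by case: (y).
  exists (sup S); have := dominated_graphZ 0 GG Gz => G0.
  exists (toK k 0 *: z.1, 0 * z.2), 1; split => //=.
  by rewrite toK0 scale0r toK1 scale1r mul0r mul1r !add0r.
Qed.

Lemma dominated_graph_total G : dominated_graph G -> G !=set0 ->
  exists f : E -> R,
    [/\ forall a x y, f (toK k a *: x + y) = a * f x + f y, forall x, f x <= p x &
        forall x, G x -> f x.1 = x.2].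
Proof.
move=> GG G0.
(* A maximal [H] is sought among those whose union with [G] is dominated, so that the empty chain
   has an upper bound too. *)
have [|H [HH Hmax]] := @Zorn_bigcup _ (fun H => dominated_graph (G `|` H)).
  move=> F FP Ftot; split.
    have [GL _] := GG.
    have inF H x y a : F H -> (G `|` H) x -> (G `|` H) y ->
        (G `|` \bigcup_(X in F) X) (toK k a *: x.1 + y.1, a * x.2 + y.2).
      move=> FH Hx Hy; have [/(_ a _ _ Hx Hy)] := FP _ FH.
      by case; [left|right; exists H].
    move=> a x y [Gx|[H FH Hx]] [Gy|[H' FH' Hy]].
    - by left; apply: GL.
    - by apply: (inF H'); [|left|right].
    - by apply: (inF H); [|right|left].
    - have [HH'|H'H] := Ftot _ _ FH FH'.
        by apply: (inF H') => //; right; [apply: HH'|].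
      by apply: (inF H) => //; right; [|apply: H'H].
  have [_ GP] := GG.
  by move=> x [/GP//|[H /FP[_ +] Hx]]; apply; right.
have GH0 : (G `|` H) !=set0 by case: G0 => x Gx; exists x; left.
have total x : exists r, (G `|` H) (x, r).
  have [H' H'D [GHH' [r H'x]]] := dominated_graph_extend x HH GH0.
  exists r; have [->//|/eqP HH'] := eqVneq (G `|` H) H'.
  case: (Hmax H').
    split; first by move=> y Hy; apply: GHH'; right.
    by move=> H'H; apply: HH'; apply/seteqP; split => // y /H'H; right.
  by rewrite (_ : _ `|` _ = H')//; apply/setUidPr => y Gy; apply: GHH'; left.
have [f fP] := choice total; have [HL HP] := HH.
exists f; split=> [a x y|x|[x r] Gx /=].
- apply: (dominated_graph_fun HH (fP _)).
  exact: (HL a _ _ (fP x) (fP y)).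
- exact: (HP _ (fP x)).
- by apply: (dominated_graph_fun HH (fP x)); left.
Qed.
End RealHahnBanach.

Section HahnBanach.
Context (R : realType) (k : scalar_kind).
Local Notation K := (scalars R k).

Lemma reKD (x y : K) : reK (x + y) = reK x + reK y.
Proof. by move: x y; rewrite /reK; case: k => //= -[a b] [c d]. Qed.

Lemma reK_toKM (r : R) (x : K) : reK (toK k r * x) = r * reK x.
Proof. by move: x; rewrite /reK /toK; case: k => //= -[a b]; rewrite /= mul0r subr0. Qed.

Lemma reK_le_nrm (x : K) : reK x <= nrm x.
Proof.
move: x; rewrite /nrm /reK; case: k => [x|[a b]] /=; first exact: (@ler_norm R x).
by rewrite (le_trans (ler_norm a))// -sqrtr_sqr ler_sqrt ?addr_ge0 ?sqr_ge0// lerDl sqr_ge0.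
Qed.

Lemma reK_inj (x y : K) : (forall c, reK (c * x) = reK (c * y)) -> x = y.
Proof.
move: x y; rewrite /reK; case: k => [x y /(_ 1)|[a b] [c d] h]; first by rewrite !mul1r.
have /= := h (Complex 1 0); have /= := h (Complex 0 1).
by rewrite !mul0r !mul1r !sub0r !subr0 => /oppr_inj -> ->.
Qed.

Lemma nrm_rotate (x : K) : exists2 c : K, nrm c = 1 & c * x = toK k (nrm x).
Proof.
have [->|x0] := eqVneq x 0.
  by exists 1; rewrite ?nrm1// mulr0 nrm0 toK0.
have nx : `|x| != 0 by rewrite normr_eq0.
exists (`|x| / x); last by rewrite mulfVK// toK_nrm.
by rewrite /nrm normrM normfV normr_id divff// -[1](toK1 R k) toKK.
Qed.

(** Over the reals [h] is [F]; over the complex numbers it is [F x - i F (i x)]. Rotating [h x] onto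
    the nonnegative half-line turns the bound on real parts into one on norms. *)
Lemma complexify (E : lmodType K) (p : seminorm E) (F : E -> R) :
  (forall a x y, F (toK k a *: x + y) = a * F x + F y) -> (forall x, F x <= p x) ->
  exists h : E -> scalar_space R k,
    [/\ linear h, forall x, reK (h x : K) = F x & forall x, nrm (h x) <= p x].
Proof.
move=> FL Fp.
suff [h [hL hF]] : exists h : E -> scalar_space R k, linear h /\ forall x, reK (h x : K) = F x.
  exists h; split=> // x; have [c c1 cx] := nrm_rotate (h x : K).
  have := Fp (c *: x); rewrite snormZ c1 mul1r -hF (linZ hL).
  by rewrite (_ : c *: h x = toK k (nrm (h x)))// toKK.
case: k E p F FL {Fp} => /= E _ F FL; first by exists F.
have FD x y : F (x + y) = F x + F y by have := FL 1 x y; rewrite mul1r scale1r.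
have F0 : F 0 = 0 by apply: (addrI (F 0)); rewrite -FD !addr0.
have FZ a x : F (Complex a 0 *: x) = a * F x by have := FL a x 0; rewrite !addr0 F0 addr0.
pose J : R[i] := Complex 0 1.
exists (fun x => Complex (F x) (- F (J *: x))); split => // -[a b] x y.
have FcZ c d z : F (Complex c d *: z) = c * F z + d * F (J *: z).
  rewrite -!FZ -FD scalerA -scalerDl; congr (F (_ *: _)).
  by apply/eqP; rewrite eq_complex /=; apply/andP; split; apply/eqP; ring.
apply/eqP; rewrite eq_complex /=; apply/andP; split; apply/eqP.
  by rewrite FD FcZ; ring.
rewrite scalerDr FD scalerA (_ : J * Complex a b = Complex (- b) a); last first.
  by apply/eqP; rewrite eq_complex /=; apply/andP; split; apply/eqP; ring.
by rewrite FcZ; ring.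
Qed.

(** The subspace is given as the image of [T], which may fail to be injective: the bound by [p]
    makes the graph of pairs [(T u, reK (f u))] single-valued. *)
Theorem hahn_banach (U E : lmodType K) (p : seminorm E) (T : U -> E)
    (f : U -> scalar_space R k) :
  linear T -> linear f -> (forall u, nrm (f u) <= p (T u)) ->
  exists h : E -> scalar_space R k,
    [/\ linear h, forall x, nrm (h x) <= p x & forall u, h (T u) = f u].
Proof.
move=> TL fL fp.
have [||F [FL Fp FT]] := @dominated_graph_total R k E p
    [set (T u, reK (f u : K)) | u in [set: U]].
- split=> [a _ _ [u _ <-] [v _ <-]|_ [u _ <-]] /=; last first.
    exact: le_trans (reK_le_nrm _) (fp u).
  exists (toK k a *: u + v) => //; rewrite TL fL.
  by congr pair; rewrite reKD -reK_toKM.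
- by exists (T 0, reK (f 0 : K)), 0.
have [h [hL hF hp]] := complexify FL Fp.
(* Agreement of real parts at all multiples [c *: u] gives agreement at [u]. *)
exists h; split => // u; apply: reK_inj => c.
rewrite -[c * h _]/(c *: (h (T u))) -[c * f u]/(c *: f u) -(linZ hL) -(linZ TL) -(linZ fL) hF.
by apply: (FT (T _, reK (f _ : K))); exists (c *: u).
Qed.

(** Hahn-Banach along the line through [x], for the functional sending [a *: x] to [a * p x]. *)
Lemma norming_functional (E : lmodType K) (p : seminorm E) (x : E) :
  exists h : E -> scalar_space R k,
    [/\ linear h, forall y, nrm (h y) <= p y & h x = toK k (p x)].
Proof.
have TL : linear (fun a : K^o => a *: x) by move=> a b c; rewrite scalerDl scalerA.
have fL : linear (fun a : K^o => a * toK k (p x) : scalar_space R k).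
  by move=> a b c; rewrite mulrDl -mulrA.
have [|h [hL hp hx]] := @hahn_banach K^o E p _ _ TL fL.
  move=> a; rewrite snormZ (_ : nrm _ = nrm a * nrm (toK k (p x)))//; last exact: nrmM.
  by rewrite /nrm (@ger0_norm _ (toK k (p x))) ?toKK// -(toK0 R k) ler_toK snorm_ge0.
by exists h; split=> //; have := hx 1; rewrite scale1r mul1r.
Qed.

Lemma norming_ihom (V : completeNormedModType K) (x : V) :
  exists f : internal_hom V (scalar_space R k), nrm f <= 1 /\ nrm (ihom_fun f x) = nrm x.
Proof.
have [h [hL hp hx]] := norming_functional (norm_seminorm V) x.
have h1 y : nrm (h y) <= 1 * nrm y by rewrite mul1r hp.
exists (mk_ihom hL h1); split; first by apply: ihom_norm_le => // y; rewrite mk_ihomE.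
rewrite mk_ihomE hx /= /nrm (_ : `|_ : scalar_space R k| = `|toK k (nrm x)|)//.
by rewrite ger0_norm ?toKK// -(toK0 R k) ler_toK nrm_ge0.
Qed.
End HahnBanach.

(** * Closed ranges and equalizers *)
Section ClosedRange.
Context (R : realType) (k : scalar_kind).
Local Notation K := (scalars R k).

(** A norming functional of the class of [x] in the quotient by the closed span of the range pulls
    back to one that annihilates the range. So this class is 0 and [x] is a limit of values of [g],
    whose preimages are Cauchy by isometry. *)
Lemma isometric_range_closed (V X : completeNormedModType K) (g : V -> X) (x : X) :
  linear g -> (forall v, nrm (g v) = nrm v) ->
  (forall phi : internal_hom X (scalar_space R k),
    (forall v, ihom_fun phi (g v) = 0) -> ihom_fun phi x = 0) ->
  exists v, g v = x.
Proof.
move=> gL gI ann.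
have qL := @quotient_pi_linear R k X (range g).
have q0 : quotient_pi (range g) x = 0.
  have [f [f1 fx]] := norming_ihom (quotient_pi (range g) x).
  apply: (@nrm_eq0 R k); rewrite -fx.
  have fqL : linear (fun y => ihom_fun f (quotient_pi (range g) y)).
    by move=> a y z; rewrite qL ihom_linear.
  have fqC y : nrm (ihom_fun f (quotient_pi (range g) y)) <= nrm f * nrm y.
    rewrite -(ler_toK k) toKM !toK_nrm (le_trans (ihom_bound _ _))//.
    by rewrite ler_wpM2l// -ler_nrm nrm_quotient_pi.
  have := ann (mk_ihom fqL fqC); rewrite mk_ihomE => ->; first exact: nrm0.
  by move=> v; rewrite mk_ihomE quotient_pi0 ?(lin0 (@ihom_linear _ _ _ _ f))//; exists v.
have approx n : exists v, nrm (x - g v) < n.+1%:R^-1.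
  have [cl _] := @quotient_pi_eq0 R k X (range g) x.
  have e0 : 0 < toK k (n.+1%:R^-1 : R) by rewrite -(toK0 R k) ltr_toK invr_gt0.
  have [y [hy]] := cl q0 _ (nbhsx_ballx x _ e0).
  rewrite -ball_normE /ball_/= -toK_nrm ltr_toK.
  suff [v <-] : exists v, g v = y by exists v.
  elim: hy => [|a _ w [v _ <-] _ [v' <-]]; first by exists 0; rewrite (lin0 gL).
  by exists (a *: v + v'); rewrite gL.
have [v hv] := choice approx.
have [l vl] : exists l, seq_lim (norm_seminorm V) v l.
  apply: banach_seq_complete => e e0; have e20 : 0 < e / 2 by rewrite divr_gt0.
  have [N hN] := inv_lt e20; exists N => m n Nm Nn /=.
  rewrite -gI (linB gL) (le_lt_trans (snorm_tri (norm_seminorm X) x _ _))//=.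
  rewrite [e]splitr ltrD//; last by rewrite (lt_trans (hv n))// hN.
  by rewrite nrmB (lt_trans (hv m))// hN.
exists l; apply/eqP; rewrite eq_sym -subr_eq0; apply/eqP/(@nrm_le0 R k) => e e0.
have e20 : 0 < e / 2 by rewrite divr_gt0.
have [N hN] := inv_lt e20; have [M hM] := vl _ e20; pose n := maxn N M.
rewrite (le_trans (snorm_tri (norm_seminorm X) (g (v n)) _ _))//= [e]splitr lerD//.
  by rewrite ltW// (lt_trans (hv n))// hN// leq_maxl.
by rewrite -(linB gL) gI ltW//; apply: hM; rewrite leq_maxr.
Qed.
End ClosedRange.

Section Equalizer.
Context (R : realType) (k : scalar_kind).
Local Notation K := (scalars R k).
Variables (A : banach_algebra K) (X Y : banach_module A) (f g : module_hom X Y).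

Definition equalized : {pred X} := fun x => f x == g x.

Let equalized_closed : submod_closed equalized.
Proof.
split=> [|a x y]; rewrite !unfold_in; first by rewrite !(lin0 (@mh_linear _ _ _ _ _)).
by move=> /eqP fgx /eqP fgy; rewrite !mh_linear fgx fgy.
Qed.

HB.instance Definition _ :=
  GRing.isSubmodClosed.Build K (X : lmodType K) equalized equalized_closed.

Definition equalizer_type : Type := {x : X | x \in equalized}.
Local Notation T := equalizer_type.
HB.instance Definition _ := [isSub of T for @proj1_sig _ _].
HB.instance Definition _ := [Choice of T by <:].
HB.instance Definition _ := [SubChoice_isSubLmodule of T by <:].

Let pT (x : T) : R := nrm (val x).
Let pTD (x y : T) : pT (x + y) <= pT x + pT y. Proof. exact: nrmD. Qed.
Let pTZ (a : K) (x : T) : pT (a *: x) = nrm a * pT x. Proof. exact: nrmZ. Qed.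
Let normT : seminorm (T : lmodType K) := @Seminorm R k T pT pTD pTZ.

Let normT0 (x : T) : normT x = 0 -> x = 0.
Proof. by move=> /nrm_eq0 x0; apply: val_inj. Qed.

Let normT_complete : seq_complete normT.
Proof.
move=> u uc.
have [|l ul] := @banach_seq_complete R k X (fun n => val (u n)); first exact: uc.
(* As [f] and [g] are contractions that agree at [u N], their values at [l] differ by at most twice
   the distance from [l] to [u N]. *)
have lP : l \in equalized.
  rewrite unfold_in -subr_eq0; apply/eqP/(@nrm_le0 R k) => e e0.
  have e20 : 0 < e / 2 by rewrite divr_gt0.
  have [N /(_ N (leqnn N)) /= hN] := ul _ e20; pose d := val (u N) - l.
  have -> : f l - g l = g d - f d.
    rewrite /d !(linB (@mh_linear _ _ _ _ _)).
    have /eqP -> : f (val (u N)) == g (val (u N)) by exact: (valP (u N)).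
    by rewrite opprB [RHS]addrC subrKA.
  have le h : nrm (mh_fun h d : Y) <= e / 2.
    by apply: le_trans (ltW hN); rewrite ler_nrm (mh_contraction h).
  by rewrite [e]splitr (le_trans (nrmD _ _))// nrmN lerD.
by exists (exist _ l lP) => e e0; have [N hN] := ul e e0; exists N.
Qed.

Definition equalizer_space : completeNormedModType K :=
  banach_of_norm normT0 normT_complete.

Let incl (x : equalizer_space) : X := val (x : T).

Let nrm_incl x : nrm (incl x) = nrm x.
Proof. by rewrite nrm_banach_of_norm. Qed.

Let actP (a : A) (x : T) : act a (val x) \in equalized.
Proof.
by rewrite unfold_in !mh_act; have /eqP -> : f (val x) == g (val x) by exact: (valP x).
Qed.

Definition equalizer_act (a : A) (x : equalizer_space) : equalizer_space :=
  exist (fun z : X => z \in equalized) (act a (val (x : T))) (actP a x).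

Definition equalizer : banach_module A.
Proof.
apply: (@BanachModule K A equalizer_space equalizer_act).
- have [al ar] := act_bilinear X.
  by split=> [x a b c|a b x y]; apply: val_inj; [exact: al|exact: ar].
- by move=> x; apply: val_inj; apply: act1.
- by move=> a b x; apply: val_inj; apply: actM.
- move=> a x; rewrite -toK_nrm -(toK_nrm x) -!nrm_incl !toK_nrm.
  exact: act_norm.
Defined.

Definition equalizer_incl : module_hom equalizer X.
Proof.
apply: (@ModuleHom K A equalizer X incl) => //.
by move=> v; rewrite -ler_nrm nrm_incl.
Defined.

Lemma nrm_equalizer_incl x : nrm (equalizer_incl x) = nrm x.
Proof. exact: nrm_incl. Qed.

Lemma equalizer_inclE x : f (equalizer_incl x) = g (equalizer_incl x).
Proof. by apply/eqP; exact: (valP (x : T)). Qed.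

Lemma equalizer_incl_surj x : f x = g x -> exists v, equalizer_incl v = x.
Proof. by move=> /eqP fgx; exists (exist (fun z : X => z \in equalized) x fgx). Qed.

End Equalizer.

(** * Splittings of dual maps *)
Section Functionals.
Context (R : realType) (k : scalar_kind).
Local Notation K := (scalars R k).

Lemma nrm_ihom (V W : completeNormedModType K) (f : internal_hom V W) (v : V) :
  nrm (ihom_fun f v) <= nrm f * nrm v.
Proof. by rewrite -(ler_toK k) toKM !toK_nrm ihom_bound. Qed.

Lemma nrm_act (C : banach_algebra K) (V : banach_module C) (c : C) (v : V) :
  nrm (act c v) <= nrm c * nrm v.
Proof. by rewrite -(ler_toK k) toKM !toK_nrm act_norm. Qed.

Lemma nrm_mh (C : banach_algebra K) (V W : banach_module C) (f : module_hom V W) (v : V) :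
  nrm (f v) <= nrm v.
Proof. by rewrite ler_nrm mh_contraction. Qed.

Variables (A : com_banach_algebra K) (B : banach_algebra K).
Variable i : banach_algebra_hom A B.
Local Notation GF V := (restrict i (extend i V)).

Lemma ext_functional (V : banach_module A) (f : B -> V -> scalar_space R k) (C : R) :
  0 <= C -> bilinear_map f -> (forall b a v, f (b ** i a) v = f b (act a v)) ->
  (forall b v, nrm (f b v) <= C * (nrm b * nrm v)) ->
  exists phi : dual_module (GF V), nrm phi <= C /\
    forall b v, ihom_fun phi (ext_tens i b v) = f b v.
Proof.
move=> C0 fL fB fC; have [h [hL hC hE]] := ext_lift C0 fL fB fC.
exists (mk_ihom hL hC : dual_space (GF V)); split; first exact: ihom_norm_le.
by move=> b v; rewrite mk_ihomE hE.
Qed.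

Lemma ext_functional_eq (V : banach_module A) (phi psi : dual_module (GF V)) :
  (forall b v, ihom_fun phi (ext_tens i b v) = ihom_fun psi (ext_tens i b v)) ->
  phi = psi.
Proof.
move=> h; apply: ihom_ext; apply: (ext_eq (C := nrm phi) (D := nrm psi) _ _ _ _ h).
- exact: ihom_linear.
- exact: nrm_ihom.
- exact: ihom_linear.
- exact: nrm_ihom.
Qed.

Lemma restrict_ext_actE (V : banach_module A) a b (v : V) :
  @act K A (GF V) a (ext_tens i b v) = ext_tens i (i a ** b) v.
Proof. exact: ext_actE. Qed.

Section OrbitFunctional.
Variables (V : banach_module A) (phi : dual_module V) (v : V).

Let orbit_linear : linear (fun a : A => ihom_fun phi (act a v)).
Proof. by have [al _] := act_bilinear V; move=> c a b; rewrite al ihom_linear. Qed.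

Let orbit_bound (a : A) : nrm (ihom_fun phi (act a v)) <= nrm phi * nrm v * nrm a.
Proof.
rewrite (le_trans (nrm_ihom _ _))// -mulrA ler_wpM2l ?nrm_ge0//.
by rewrite mulrC nrm_act.
Qed.

(** The matrix coefficient of [phi] and [v], a functional on [A] to which [s] applies. *)
Definition orbit_functional : dual_module (regular_module A) :=
  mk_ihom orbit_linear orbit_bound : dual_space (regular_module A).

Lemma orbit_functionalE a : ihom_fun orbit_functional a = ihom_fun phi (act a v).
Proof. exact: mk_ihomE. Qed.

Lemma nrm_orbit_functional : nrm orbit_functional <= nrm phi * nrm v.
Proof. by apply: ihom_norm_le; rewrite ?mulr_ge0 ?nrm_ge0. Qed.
End OrbitFunctional.

Lemma dual_module_actE (V : banach_module A) (a : A) (phi : dual_module V) v :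
  ihom_fun (act a phi) v = ihom_fun phi (act a v).
Proof. exact: dual_actE. Qed.

Lemma dual_module_lin (V : banach_module A) c (phi psi : dual_module V) v :
  ihom_fun (c *: phi + psi) v = c *: ihom_fun phi v + ihom_fun psi v.
Proof. exact: ihom_lin. Qed.

Lemma dual_mapE (V W : banach_module A) (f : module_hom V W) (phi : dual_module W) v :
  ihom_fun (dual_map f phi) v = ihom_fun phi (f v).
Proof. exact: mk_ihomE. Qed.

Section DualSplitting.
Variable s : module_hom (dual_module (regular_module A))
                        (dual_module (restrict i (regular_module B))).
Hypothesis i_central : central_hom i.

Let splitting_functional (V : banach_module A) (phi : dual_module V) :
  exists psi : dual_module (GF V), nrm psi <= nrm phi /\
    forall b v, ihom_fun psi (ext_tens i b v) = ihom_fun (s (orbit_functional phi v)) b.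
Proof.
apply: ext_functional; first exact: nrm_ge0.
- split=> [v a b c|b a v w]; first by rewrite ihom_linear.
  rewrite -dual_module_lin -mh_linear; congr (ihom_fun (s _) b); apply: ihom_ext => x.
  rewrite dual_module_lin !orbit_functionalE.
  by have [_ ar] := act_bilinear V; rewrite ar ihom_linear.
(* Centrality moves [i a] to the left of [b], where it is the action of [a] on [B]. Since [s] is
   [A]-linear, it passes to the orbit functional, and commutativity of [A] moves it onto [v]. *)
- move=> b a v; rewrite -i_central.
  rewrite -[LHS](dual_module_actE a (s (orbit_functional phi v))) -mh_act.
  congr (ihom_fun (s _) b); apply: ihom_ext => x.
  by rewrite dual_module_actE !orbit_functionalE /= bmulC actM.
- move=> b v; rewrite (le_trans (nrm_ihom _ _))//.
  rewrite [nrm b * _]mulrC mulrA ler_wpM2r ?nrm_ge0//.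
  apply: le_trans (nrm_orbit_functional phi v); exact: (nrm_mh s).
Qed.

Lemma dual_splitting_exists (V : banach_module A) :
  exists sigma : module_hom (dual_module V) (dual_module (GF V)),
    forall phi b v, ihom_fun (sigma phi) (ext_tens i b v) =
                    ihom_fun (s (orbit_functional phi v)) b.
Proof.
have [S hS] := choice (@splitting_functional V).
have SE phi b v : ihom_fun (S phi) (ext_tens i b v) =
    ihom_fun (s (orbit_functional phi v)) b by have [_] := hS phi.
have SL : linear S.
  move=> a phi psi; apply: ext_functional_eq => b v.
  rewrite dual_module_lin !SE -dual_module_lin -mh_linear.
  congr (ihom_fun (s _) b); apply: ihom_ext => x.
  by rewrite dual_module_lin !orbit_functionalE dual_module_lin.
have SA a phi : S (act a phi) = act a (S phi).
  apply: ext_functional_eq => b v.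
  rewrite dual_module_actE restrict_ext_actE !SE.
  rewrite -[RHS](dual_module_actE a (s (orbit_functional phi v))) -mh_act.
  congr (ihom_fun (s _) b); apply: ihom_ext => x.
  by rewrite dual_module_actE !orbit_functionalE dual_module_actE actM.
have SC phi : `|S phi| <= `|phi| by rewrite -ler_nrm; have [] := hS phi.
by exists (ModuleHom SL SA SC).
Qed.

Definition dual_splitting (V : banach_module A) :
  module_hom (dual_module V) (dual_module (GF V)) := projT1 (cid (dual_splitting_exists V)).

Lemma dual_splittingE V phi b v : ihom_fun (dual_splitting V phi) (ext_tens i b v) =
  ihom_fun (s (orbit_functional phi v)) b.
Proof. by rewrite /dual_splitting; case: cid. Qed.

(** On elementary tensors: as [m] is [A]-linear, [psi] and [m v] have the same orbit functional as
    [dual_map m psi] and [v]. *)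
Lemma dual_splitting_nat (V W : banach_module A) (m : module_hom V W)
    (psi : dual_module W) (u : GF V) :
  ihom_fun (dual_splitting W psi) (extend_hom i m u) =
  ihom_fun (dual_splitting V (dual_map m psi)) u.
Proof.
pose Gm := restrict_hom i (extend_hom i m).
rewrite -[LHS](dual_mapE Gm); congr (ihom_fun _ u); apply: ext_functional_eq => b v.
rewrite dual_mapE /= extend_homE !dual_splittingE; congr (ihom_fun (s _) b).
by apply: ihom_ext => x; rewrite !orbit_functionalE dual_mapE mh_act.
Qed.

Hypothesis sK : forall f, dual_map (algebra_map i) (s f) = f.

(** The unit of [B] is the image of that of [A], and along [i] the functional [s f] restricts to
    [f]. *)
Lemma dual_splitting_unit (V : banach_module A) (phi : dual_module V) (v : V) :
  ihom_fun (dual_splitting V phi) (extension_unit i V v) = ihom_fun phi v.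
Proof.
rewrite /= dual_splittingE -(bah1 i) -[LHS](dual_mapE (algebra_map i)) sK.
by rewrite orbit_functionalE act1.
Qed.

(** A norming functional of [v] is carried by the contraction [dual_splitting] to one of norm at
    most 1 with the same value at the image of [v]. *)
Lemma extension_unit_isometric (V : banach_module A) v :
  nrm (extension_unit i V v) = nrm v.
Proof.
apply/eqP; rewrite eq_le nrm_mh /=.
have [phi [phi1 <-]] := norming_ihom v.
rewrite -(dual_splitting_unit phi) (le_trans (nrm_ihom _ _))//.
apply: ler_piMl; first exact: nrm_ge0.
by apply: le_trans phi1; exact: (nrm_mh (dual_splitting V)).
Qed.

End DualSplitting.
End Functionals.

(** * The quantitative closed range theorem for pairs with contractible dual *)

Section SplitPair.
Context (R : realType) (k : scalar_kind).
Local Notation K := (scalars R k).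
Variables (A : com_banach_algebra K) (X Y : banach_module A) (th et : module_hom X Y).
Variable sg : module_hom (dual_module X) (dual_module Y).
(** In terms of dual maps, [et^* sg = id] and [th^* sg th^* = th^* sg et^*]. *)
Hypothesis et_sg : forall phi x, ihom_fun (sg phi) (et x) = ihom_fun phi x.
Hypothesis th_sg : forall (h : dual_module Y) x,
  ihom_fun (sg (dual_map th h)) (th x) = ihom_fun (sg (dual_map et h)) (th x).

Let T (x : X) : Y := th x - et x.

Let TL : linear T.
Proof. by move=> a x y; rewrite /T !mh_linear scalerBr opprD addrACA. Qed.

Let T_bound x : nrm (T x) <= 2 * nrm x.
Proof. by rewrite (le_trans (nrmD _ _))// nrmN mulrDl mul1r lerD// nrm_mh. Qed.

Let dual_lin (V : banach_module A) (f g : dual_module V) v :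
  ihom_fun (- 1 *: f + g) v = ihom_fun g v - ihom_fun f v.
Proof. by rewrite dual_module_lin scaleN1r addrC. Qed.

(* Functionals factoring through T are killed by the idempotent th^* sg. *)
Let sg_diff (f : dual_module X) (h : dual_module Y) :
  (forall x, ihom_fun f x = ihom_fun h (T x)) -> forall x, ihom_fun (sg f) (th x) = 0.
Proof.
move=> fh x; have -> : f = -1 *: dual_map et h + dual_map th h.
  by apply: ihom_ext => y; rewrite dual_lin !dual_mapE fh (linB (@ihom_linear _ _ _ _ h)).
by rewrite mh_linear dual_lin th_sg subrr.
Qed.

Section PenalizedNorm.
Variable M : R.
Hypothesis M0 : 0 <= M.

Let S (y : Y) : set R := [set r | exists x, nrm x + M * nrm (y - T x) <= r].

Let S_nonempty y : S y !=set0.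
Proof. by exists (nrm (0 : X) + M * nrm (y - T 0)); exists 0. Qed.
Let S_ge0 y r : S y r -> 0 <= r.
Proof. by move=> [x]; apply: le_trans; rewrite addr_ge0 ?mulr_ge0 ?nrm_ge0. Qed.
Let SD y z r s : S y r -> S z s -> S (y + z) (r + s).
Proof.
move=> [x xr] [x' xs]; exists (x + x'); rewrite (linD TL) opprD addrACA.
apply: le_trans (lerD xr xs); rewrite [leRHS]addrACA -mulrDr.
by rewrite lerD ?ler_wpM2l ?nrmD.
Qed.
Let SZ (a : K) y r : S y r -> S (a *: y) (nrm a * r).
Proof.
move=> [x xr]; exists (a *: x); rewrite (linZ TL) -scalerBr !nrmZ mulrCA -mulrDr.
by rewrite ler_wpM2l ?nrm_ge0.
Qed.

(* A functional f with |f| <= penalized_norm pulls back along T to one of norm at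
   most 1, and is bounded by M on Y.  That [penalized_norm (T x) <= nrm (T x)] for
   every M is a quantitative form of the openness of T onto its range. *)
Definition penalized_norm : seminorm Y := inf_seminorm S_nonempty S_ge0 SD SZ.

Let penalized_le y x : penalized_norm y <= nrm x + M * nrm (y - T x).
Proof. by apply: inf_snorm_le => //; exists x. Qed.

Lemma penalized_lt y r : penalized_norm y < r ->
  exists x, nrm x + M * nrm (y - T x) < r.
Proof.
move=> yr; have [c [x xc] cr] : exists2 c, S y c & c < r.
  by apply: inf_lt => //; split=> //; exists 0; apply: S_ge0.
by exists x; apply: le_lt_trans cr.
Qed.

(** Let [h] be norming for [T x] and let [f] be its pullback along [T], of norm at most 1. Since
    [sg f] vanishes at [th x] and equals [f x] at [et x], its value at [T x] is [- h (T x)]; this is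
    bounded by the norm of [T x] because [sg] is a contraction. *)
Lemma penalized_norm_range x : penalized_norm (T x) <= nrm (T x).
Proof.
have [h [hL hp hx]] := norming_functional penalized_norm (T x).
have hM y : nrm (h y) <= M * nrm y.
  by rewrite (le_trans (hp y))// (le_trans (penalized_le y 0))// nrm0 add0r (lin0 TL) subr0.
pose H : dual_module Y := mk_ihom hL hM : dual_space Y.
have TC z : nrm (h (T z)) <= 1 * nrm z.
  by rewrite mul1r (le_trans (hp _))// (le_trans (penalized_le _ z))// subrr nrm0 mulr0 addr0.
have hTL : linear (fun z => h (T z)) by move=> a y z; rewrite TL hL.
pose f : dual_module X := mk_ihom hTL TC : dual_space X.
have sgf : ihom_fun (sg f) (T x) = - h (T x).
  rewrite (linB (@ihom_linear _ _ _ _ (sg f))) et_sg (@sg_diff _ H) ?sub0r//.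
have -> : penalized_norm (T x) = nrm (h (T x)).
  rewrite hx /nrm (_ : `|_ : scalar_space R k| = `|toK k (penalized_norm (T x))|)//.
  by rewrite ger0_norm ?toKK// -(toK0 R k) ler_toK snorm_ge0.
rewrite -nrmN -sgf (le_trans (nrm_ihom _ _))//.
apply: ler_piMl; first exact: nrm_ge0.
by apply: (le_trans (nrm_mh sg f)); apply: ihom_norm_le.
Qed.
End PenalizedNorm.

Let almost_solution x : exists x', nrm x' <= 2 * nrm (T x) /\
  nrm (T (x - x')) <= nrm (T x) / 2.
Proof.
have [Tx0|Tx0] := eqVneq (nrm (T x)) 0.
  by exists 0; rewrite subr0 Tx0 nrm0 mulr0 mul0r.
have {}Tx0 : 0 < nrm (T x) by rewrite lt_neqAle eq_sym Tx0 nrm_ge0.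
(* With the weight 4, a penalized sum below [2 * nrm (T x)] yields both bounds at once. *)
have M0 : 0 <= 4 :> R by [].
have [|x' hx'] := @penalized_lt _ M0 (T x) (2 * nrm (T x)).
  by apply: (le_lt_trans (penalized_norm_range M0 x)); lra.
exists x'; rewrite (linB TL).
by move: hx'; have := nrm_ge0 x'; have := nrm_ge0 (T x - T x'); lra.
Qed.

(** Subtracting almost solutions repeatedly halves [T (u n)] at each step, and the corrections, of
    norm at most [2 * c * 2^-1 ^+ n], sum to at most [4 * c]. *)
Lemma dist_kernel x : exists v, th v = et v /\ nrm (x - v) <= 4 * nrm (T x).
Proof.
have [S hS] := choice almost_solution.
pose u := fix u n := if n is m.+1 then u m - S (u m) else x.
set c := nrm (T x); have c0 : 0 <= c := nrm_ge0 _.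
have uT n : nrm (T (u n)) <= c * 2^-1 ^+ n.
  elim: n => [|n IH]; first by rewrite expr0 mulr1.
  have [_ /=] := hS (u n); rewrite exprS; move: IH.
  by move: (nrm _) (nrm _) (_ ^+ n) => *; lra.
(* Each correction bound is written as the telescoping difference
   [4 * c * 2^-1 ^+ n - 4 * c * 2^-1 ^+ n.+1]. *)
have uS n j : nrm (u (n + j)%N - u n) <= 4 * c * 2^-1 ^+ n - 4 * c * 2^-1 ^+ (n + j).
  elim: j => [|j IH]; first by rewrite addn0 !subrr nrm0.
  rewrite addnS /= addrAC (le_trans (nrmD _ _))// nrmN exprS.
  have [+ _] := hS (u (n + j)%N); have := uT (n + j)%N; move: IH.
  move: (nrm _) (nrm _) (nrm _) (_ ^+ n) (_ ^+ (n + j)%N) => *; lra.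
have pow0 n : 0 <= 2^-1 ^+ n :> R by rewrite exprn_ge0 ?invr_ge0.
have small e : 0 < e -> exists N, forall n, (N <= n)%N -> 4 * c * 2^-1 ^+ n < e.
  (* The summand 1 keeps the divisor positive when [c] is 0. *)
  move=> e0; have c1 : 0 < 4 * c + 1 by lra.
  have [N hN] := inv_lt (divr_gt0 e0 c1); exists N => n Nn.
  apply: (@le_lt_trans _ _ ((4 * c + 1) * n.+1%:R^-1)); last first.
    by rewrite mulrC -ltr_pdivlMr// hN.
  apply: ler_pM => //; [by rewrite mulr_ge0|by lra|].
  rewrite exprVn lef_pV2 ?posrE ?exprn_gt0 ?ltr0n//.
  by rewrite -natrX ler_nat ltn_expl.
have near n m : (n <= m)%N -> nrm (u m - u n) <= 4 * c * 2^-1 ^+ n.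
  move=> nm; rewrite -(subnKC nm) (le_trans (uS _ _))//.
  by rewrite gerBl !mulr_ge0.
have [v uv] : exists v, seq_lim (norm_seminorm X) u v.
  apply: banach_seq_complete => e e0; have e20 : 0 < e / 2 by rewrite divr_gt0.
  have [N hN] := small _ e20; exists N => m n Nm Nn.
  rewrite (le_lt_trans (snorm_tri (norm_seminorm X) (u N) _ _))//= [e]splitr ltrD//.
    by rewrite (le_lt_trans (near _ _ Nm))// hN.
  by rewrite nrmB (le_lt_trans (near _ _ Nn))// hN.
exists v; split.
  apply/eqP; rewrite -subr_eq0 -/(T v); apply/eqP/(@nrm_le0 R k) => e e0.
  have e40 : 0 < e / 4 by rewrite divr_gt0.
  have [N hN] := small _ e40; have [L hL] := uv _ e40; pose n := maxn N L.
  have := snorm_dist (norm_seminorm Y) (T v) (T (u n)) => /= /le_trans; apply.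
  have h1 : nrm (T (u n)) <= e / 4.
    apply: (le_trans (uT n)); apply: le_trans (ltW (hN n (leq_maxl _ _))).
    by have := mulr_ge0 c0 (pow0 n); rewrite -mulrA; lra.
  have h2 : nrm (T v - T (u n)) <= 2 * (e / 4).
    rewrite -(linB TL) (le_trans (T_bound _))// ler_wpM2l// nrmB ltW//.
    by apply: hL; rewrite leq_maxr.
  by lra.
apply/ler_addgt0Pr => e e0; have [L hL] := uv _ e0.
have := snorm_tri (norm_seminorm X) (u L) x v => /= /le_trans; apply.
apply: lerD; last by rewrite ltW// hL.
by have := near 0%N L (leq0n _); rewrite expr0 mulr1 nrmB.
Qed.

(** By [dist_kernel], a functional vanishing on the kernel of [T] is bounded at [x] by a multiple of
    the norm of [T x]; Hahn-Banach then factors it through [T]. *)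
Lemma splitting_annihilator (f : dual_module X) :
  (forall v, th v = et v -> ihom_fun f v = 0) -> forall x, ihom_fun (sg f) (th x) = 0.
Proof.
move=> f0; pose C := nrm f * 4.
have C0 : 0 <= C by rewrite mulr_ge0 ?nrm_ge0.
have pD (x y : Y) : C * nrm (x + y) <= C * nrm x + C * nrm y.
  by rewrite -mulrDr ler_wpM2l ?nrmD.
have pZ (a : K) (x : Y) : C * nrm (a *: x) = nrm a * (C * nrm x).
  by rewrite nrmZ mulrCA.
have [|h [hL hC hT]] := @hahn_banach R k X Y (Seminorm pD pZ) T (ihom_fun f) TL (@ihom_linear _ _ _ _ f).
  move=> x /=; have [v [vE xv]] := dist_kernel x.
  have -> : ihom_fun f x = ihom_fun f (x - v).
    by rewrite (linB (@ihom_linear _ _ _ _ f)) (f0 v vE) subr0.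
  by rewrite (le_trans (nrm_ihom _ _))// -mulrA ler_wpM2l ?nrm_ge0.
apply: (@sg_diff f (mk_ihom hL hC : dual_space Y)) => x.
by rewrite mk_ihomE hT.
Qed.

(** The factorization of [f] through [T] is now explicit and [A]-linear in [f], so it can be used
    for all elements of [B] simultaneously after extension of scalars. *)
Lemma annihilator_splitting (f : dual_module X) :
  (forall v, th v = et v -> ihom_fun f v = 0) ->
  forall x, ihom_fun f x = ihom_fun (sg f) (et x - th x).
Proof.
move=> f0 x; rewrite (linB (@ihom_linear _ _ _ _ (sg f))) et_sg.
by rewrite splitting_annihilator// subr0.
Qed.

(** The section sends [phi] to [th^* sg (E phi)], with [E phi] a Hahn-Banach extension of the same
    norm bound. Two extensions differ by a functional killed by [th^* sg], so the section is linear
    although [E] is a mere choice. *)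
Lemma equalizer_weak_retract : weak_retract (equalizer_incl th et).
Proof.
pose e := equalizer_incl th et.
have ext (phi : dual_module (equalizer th et)) : exists f : dual_module X,
    nrm f <= nrm phi /\ forall v, ihom_fun f (e v) = ihom_fun phi v.
  have pD (x y : X) : nrm phi * nrm (x + y) <= nrm phi * nrm x + nrm phi * nrm y.
    by rewrite -mulrDr ler_wpM2l ?nrmD ?nrm_ge0.
  have pZ (a : K) (x : X) : nrm phi * nrm (a *: x) = nrm a * (nrm phi * nrm x).
    by rewrite nrmZ mulrCA.
  have [|h [hL hC hT]] := @hahn_banach R k _ X (Seminorm pD pZ) e (ihom_fun phi)
      (mh_linear e) (@ihom_linear _ _ _ _ phi).
    by move=> v /=; rewrite nrm_equalizer_incl nrm_ihom.
  exists (mk_ihom hL hC : dual_space X); split; last by move=> v; rewrite mk_ihomE hT.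
  by apply: ihom_norm_le; first exact: nrm_ge0.
have [E hE] := choice ext.
have EE phi v : ihom_fun (E phi) (e v) = ihom_fun phi v by have [] := hE phi.
have agree (f g : dual_module X) :
    (forall v, ihom_fun f (e v) = ihom_fun g (e v)) ->
    dual_map th (sg f) = dual_map th (sg g).
  move=> fg; apply: ihom_ext => x; rewrite !dual_mapE; apply/eqP.
  rewrite -subr_eq0 -dual_lin -mh_linear; apply/eqP/splitting_annihilator => y.
  by move=> /equalizer_incl_surj[v <-]; rewrite dual_lin fg subrr.
have tL : linear (fun phi => dual_map th (sg (E phi))).
  move=> a phi psi; rewrite -!mh_linear; apply: agree => v.
  by rewrite dual_module_lin !EE dual_module_lin.
have tA a phi : dual_map th (sg (E (act a phi))) = act a (dual_map th (sg (E phi))).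
  rewrite -!mh_act; apply: agree => v.
  by rewrite dual_module_actE -mh_act !EE dual_module_actE.
have tC phi : `|dual_map th (sg (E phi))| <= `|phi|.
  apply: (le_trans (mh_contraction _ _)); apply: (le_trans (mh_contraction _ _)).
  by rewrite -ler_nrm; have [] := hE phi.
exists (ModuleHom tL tA tC); apply: module_hom_ext => phi; apply: ihom_ext => v.
rewrite [LHS](dual_mapE e (dual_map th (sg (E phi)))) dual_mapE equalizer_inclE et_sg.
exact: EE.
Qed.
End SplitPair.

(** * Extension of scalars *)
Section Descent.
Context (R : realType) (k : scalar_kind).
Local Notation K := (scalars R k).
Variables (A : com_banach_algebra K) (B : banach_algebra K).
Variable i : banach_algebra_hom A B.
Local Notation GF V := (restrict i (extend i V)).

Section Curry.
Variables (V : banach_module A) (phi : dual_module (GF V)) (b : B).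

Let curry_linear : linear (fun v : V => ihom_fun phi (ext_tens i b v)).
Proof. by have [_ er] := ext_tens_bilinear i V; move=> c v w; rewrite er ihom_linear. Qed.

Let curry_bound (v : V) : nrm (ihom_fun phi (ext_tens i b v)) <= nrm phi * nrm b * nrm v.
Proof.
rewrite (le_trans (nrm_ihom _ _))// -mulrA ler_wpM2l ?nrm_ge0//.
exact: nrm_ext_tens.
Qed.

Definition curry_functional : dual_module V :=
  mk_ihom curry_linear curry_bound : dual_space V.

Lemma curry_functionalE v : ihom_fun curry_functional v = ihom_fun phi (ext_tens i b v).
Proof. exact: mk_ihomE. Qed.

Lemma nrm_curry_functional : nrm curry_functional <= nrm phi * nrm b.
Proof. by apply: ihom_norm_le; rewrite ?mulr_ge0 ?nrm_ge0. Qed.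
End Curry.

(* Under (B (x)_A V)^* = Hom_A(B, V^* ), this is composition with t. *)
Lemma extend_dual_hom (V X : banach_module A) (t : module_hom (dual_module V) (dual_module X))
    (phi : dual_module (GF V)) :
  exists psi : dual_module (GF X), nrm psi <= nrm phi /\
    forall b x, ihom_fun psi (ext_tens i b x) = ihom_fun (t (curry_functional phi b)) x.
Proof.
have [el er] := ext_tens_bilinear i V.
apply: ext_functional; first exact: nrm_ge0.
- split=> [x a b c|b a x y]; last by rewrite ihom_linear.
  rewrite -dual_module_lin -mh_linear; congr (ihom_fun (t _) x); apply: ihom_ext => v.
  by rewrite dual_module_lin !curry_functionalE el ihom_linear.
- move=> b a x.
  rewrite -[RHS](dual_module_actE a (t (curry_functional phi b))) -mh_act.
  congr (ihom_fun (t _) x); apply: ihom_ext => v.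
  by rewrite dual_module_actE !curry_functionalE ext_tens_balanced.
- move=> b x; rewrite (le_trans (nrm_ihom _ _))// mulrA ler_wpM2r ?nrm_ge0//.
  by apply: le_trans (nrm_curry_functional phi b); exact: (nrm_mh t).
Qed.

(** A norming functional [phi] of [u] extends along [extend_hom i e], without increase of norm, to
    the functional [psi] obtained by applying the section [t] to each [curry_functional phi b]. *)
Lemma extend_weak_retract_isometric (V X : banach_module A) (e : module_hom V X)
    (u : extend i V) : weak_retract e -> nrm (extend_hom i e u) = nrm u.
Proof.
move=> [t et]; apply/eqP; rewrite eq_le nrm_mh /=.
have [phi [phi1 <-]] := norming_ihom u.
have [psi [psi1 psiE]] := extend_dual_hom t (phi : dual_module (GF V)).
have psi_e : dual_map (restrict_hom i (extend_hom i e)) psi = phi :> dual_module (GF V).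
  apply: ext_functional_eq => b v; rewrite dual_mapE /= extend_homE psiE.
  rewrite -[LHS](dual_mapE e) -curry_functionalE; congr (ihom_fun _ v).
  exact: (congr1 (fun f : module_hom _ _ => f (curry_functional phi b)) et).
have <- : ihom_fun psi (extend_hom i e u) = ihom_fun phi u.
  rewrite -[LHS](dual_mapE (restrict_hom i (extend_hom i e)) psi u).
  exact: (congr1 (fun f : dual_module (GF V) => ihom_fun f u) psi_e).
rewrite (le_trans (nrm_ihom _ _))//.
apply: ler_piMl; first exact: nrm_ge0.
exact: le_trans psi1 phi1.
Qed.

Section SplitPairExact.
Variables (X Y : banach_module A) (th et : module_hom X Y).
Variable sg : module_hom (dual_module X) (dual_module Y).
Hypothesis et_sg : forall phi x, ihom_fun (sg phi) (et x) = ihom_fun phi x.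
Hypothesis th_sg : forall (h : dual_module Y) x,
  ihom_fun (sg (dual_map th h)) (th x) = ihom_fun (sg (dual_map et h)) (th x).

Lemma extend_equalizer_isometric (u : extend i (equalizer th et)) :
  nrm (extend_hom i (equalizer_incl th et) u) = nrm u.
Proof. by apply: extend_weak_retract_isometric; apply: (equalizer_weak_retract et_sg th_sg). Qed.

(** If [phi] annihilates the range, each [curry_functional phi b] annihilates the equalizer. Then
    [annihilator_splitting] factors [phi] through the difference of the two extended maps, which
    vanishes at [u]. *)
Lemma extend_equalizer_exact (u : extend i X) :
  extend_hom i th u = extend_hom i et u ->
  exists w, extend_hom i (equalizer_incl th et) w = u.
Proof.
move=> uE; apply: (isometric_range_closed (mh_linear _) extend_equalizer_isometric) => phi phi0.
have [psi [_ psiE]] := extend_dual_hom sg (phi : dual_module (GF X)).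
pose Gth := restrict_hom i (extend_hom i th); pose Get := restrict_hom i (extend_hom i et).
have phiE : phi = -1 *: dual_map Gth psi + dual_map Get psi :> dual_module (GF X).
  apply: ext_functional_eq => b x.
  rewrite dual_module_lin !dual_mapE /= !extend_homE !psiE -curry_functionalE scaleN1r addrC.
  rewrite -(linB (@ihom_linear _ _ _ _ (sg _))).
  apply: (annihilator_splitting et_sg th_sg) => v /equalizer_incl_surj[w <-].
  by rewrite curry_functionalE -(phi0 (ext_tens i b w)) extend_homE.
have : ihom_fun (phi : dual_module (GF X)) u = 0; last by [].
rewrite phiE dual_module_lin (dual_mapE Gth psi u) (dual_mapE Get psi u).
by rewrite [Gth u]uE scaleN1r addNr.
Qed.
End SplitPairExact.

Section WeakRetract.
Variable s : module_hom (dual_module (regular_module A))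
                        (dual_module (restrict i (regular_module B))).
Hypothesis i_central : central_hom i.
Hypothesis sK : forall f, dual_map (algebra_map i) (s f) = f.

(** For [phi] annihilating the range, [phi x] is the splitting of [phi] at the unit of [x], hence,
    by the hypothesis and naturality, the splitting of [dual_map (extension_unit i V) phi = 0] at
    [x]. *)
Lemma extension_unit_exact (V : banach_module A) (x : extend i V) :
  extend_hom i (extension_unit i V) x = extension_unit i (GF V) x ->
  exists v, extension_unit i V v = x.
Proof.
move=> xE.
apply: (isometric_range_closed (mh_linear _) (extension_unit_isometric i_central sK (V := V))).
move=> phi phi0; rewrite -(dual_splitting_unit i_central sK (phi : dual_module (GF V))) -xE.
rewrite (dual_splitting_nat s i_central (extension_unit i V)).
have -> : dual_map (extension_unit i V) phi = 0.
  by apply: ihom_ext => v; rewrite dual_mapE phi0.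
by rewrite (lin0 (@mh_linear _ _ _ _ _)).
Qed.

Section Coalgebra.
Variables (N : banach_module B) (theta : module_hom N (extend i (restrict i N))).
Local Notation X := (restrict i N).
Hypothesis theta_counit : forall n, extension_counit i N (theta n) = n.
Hypothesis theta_coassoc : forall n,
  extend_hom i (extension_unit i X) (theta n) =
  extend_hom i (restrict_hom i theta) (theta n).

Let th : module_hom X (GF X) := restrict_hom i theta.
Let et : module_hom X (GF X) := extension_unit i X.
Let sg := dual_splitting s i_central X.
Let e := equalizer_incl th et.

Let et_sg phi x : ihom_fun (sg phi) (et x) = ihom_fun phi x.
Proof. exact: dual_splitting_unit. Qed.

(** By naturality both sides evaluate the splitting of [h] at points that coassociativity
    identifies. *)
Let th_sg (h : dual_module (GF X)) x :
  ihom_fun (sg (dual_map th h)) (th x) = ihom_fun (sg (dual_map et h)) (th x).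
Proof. by rewrite -!dual_splitting_nat; congr ihom_fun; rewrite -theta_coassoc. Qed.

Definition descent_map : module_hom (extend i (equalizer th et)) N :=
  module_comp (extension_counit i N) (extend_hom i e).

(** On [b] tensor [v]: [theta] is [B]-linear and agrees with the unit on the equalizer. *)
Lemma descent_mapE u : theta (descent_map u) = extend_hom i e u.
Proof.
suff -> : extend_hom i e = module_comp theta descent_map by [].
apply: extend_hom_eq => b v; rewrite /= extend_homE.
rewrite (extension_counitE i b (e v : X)) mh_act.
have h : theta (e v) = ext_tens i (bone B) (e v : X) := @equalizer_inclE _ _ _ _ _ th et v.
by rewrite h [RHS](@ext_actE _ _ _ _ i X b (bone B) (e v)) bmulb1.
Qed.

(** Composing with the contraction [theta] gives the isometry [extend_hom i e]. *)
Lemma descent_map_isometric u : nrm (descent_map u) = nrm u.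
Proof.
apply/eqP; rewrite eq_le nrm_mh andTb -(extend_equalizer_isometric et_sg th_sg u).
by have := nrm_mh theta (descent_map u); rewrite descent_mapE.
Qed.

(** By coassociativity and exactness [theta n] comes from some [w]; the counit then recovers [n]. *)
Lemma descent_map_surj n : exists u, descent_map u = n.
Proof.
have [|w hw] := @extend_equalizer_exact _ _ _ _ sg et_sg th_sg (theta n).
  by rewrite theta_coassoc.
by exists w; rewrite -[RHS]theta_counit -hw.
Qed.
End Coalgebra.
End WeakRetract.
End Descent.

(** * Comonadicity *)
Section FullyFaithful.
Variables (C D : category) (F : functor C D).

Definition faithful : Prop :=
  forall (x y : C) (f g : hom x y), fmap F f = fmap F g -> f = g.

Definition full : Prop :=
  forall (x y : C) (h : hom (F x) (F y)), exists f : hom x y, fmap F f = h.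

Lemma equivalence_faithful : is_equivalence F -> faithful.
Proof.
move=> [G [[t [tN tI]] _]] x y f g fg.
have [t' [_ tt']] := tI x.
have h : compose f (t x) = compose g (t x).
  by have /= -> := tN _ _ f; have /= -> := tN _ _ g; rewrite fg.
have := congr1 (fun h => compose h t') h.
by rewrite /= -!composeA tt' !compose_idr.
Qed.
End FullyFaithful.

Section Equivalence.
Variables (C D : category) (F : functor C D).

(** The quasi-inverse [G] is itself faithful, so it suffices to find [f] with
    [fmap G (fmap F f) = fmap G h]: conjugate [fmap G h] by [t]. *)
Lemma equivalence_full : is_equivalence F -> full F.
Proof.
move=> FE; have [G [[t [tN tI]] [u [uN uI]]]] := FE.
have Gfaithful : faithful G.
  apply: equivalence_faithful; exists F; split; first by exists u.
  by exists t.
move=> x y h; have [t' [t't tt']] := tI x.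
pose f : hom x y := compose (t y) (compose (fmap G h) t').
exists f; apply: Gfaithful; have /= E := tN _ _ f; have [s' [s't _]] := tI y.
have -> : fmap G (fmap F f) = compose s' (compose f (t x)).
  by rewrite [compose f _]E composeA s't compose_idl.
by rewrite /f -!composeA t't compose_idr composeA s't compose_idl.
Qed.

Lemma fully_faithful_equivalence : faithful F -> full F ->
  (forall d : D, exists (c : C) (f : hom (F c) d), is_iso f) -> is_equivalence F.
Proof.
move=> Ff Fu Fe.
pose o (d : D) : C := projT1 (cid (Fe d)).
pose a (d : D) : hom (F (o d)) d := projT1 (cid (projT2 (cid (Fe d)))).
have /= aI d : is_iso (a d) by exact: (projT2 (cid (projT2 (cid (Fe d))))).
pose b (d : D) : hom d (F (o d)) := projT1 (cid (aI d)).
have ba d : compose (b d) (a d) = idm _ by have [] := projT2 (cid (aI d)).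
have ab d : compose (a d) (b d) = idm _ by have [] := projT2 (cid (aI d)).
pose ar (d d' : D) (h : hom d d') : hom (o d) (o d') :=
  projT1 (cid (Fu _ _ (compose (b d') (compose h (a d))))).
have arE d d' h : fmap F (@ar d d' h) = compose (b d') (compose h (a d)).
  by rewrite /ar; case: cid.
have ar1 d : ar _ _ (idm d) = idm (o d).
  by apply: Ff; rewrite arE compose_idl ba fmap_id.
have arM d d' d'' (g : hom d' d'') (f : hom d d') :
    ar _ _ (compose g f) = compose (ar _ _ g) (ar _ _ f).
  apply: Ff; rewrite fmap_comp !arE -!composeA; congr compose.
  by congr compose; rewrite [RHS]composeA [compose (a d') _]ab compose_idl.
exists (Functor ar1 arM); split.
  pose t (x : C) : hom (o (F x)) x := projT1 (cid (Fu _ _ (a (F x)))).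
  have tE x : fmap F (t x) = a (F x) by rewrite /t; case: cid.
  exists t; split=> [x y f|x].
    apply: Ff; rewrite /= !fmap_comp !tE arE composeA ab compose_idl.
    by [].
  have [t' t'E] := Fu _ _ (b (F x)); exists t'.
  by split; apply: Ff; rewrite fmap_comp fmap_id tE t'E; [exact: ba|exact: ab].
exists a; split=> [d d' h|d]; last exact: aI.
by rewrite /= arE composeA ab compose_idl.
Qed.
End Equivalence.

Lemma coalgebra_iso (D : category) (T : comonad D) (X Y : coalgebra_category T)
    (f : hom X Y) : is_iso (coalg_fun f) -> is_iso f.
Proof.
move=> [g [gf fg]].
have gP : compose (coalg_map X) g = compose (fmap T g) (coalg_map Y).
  rewrite -[coalg_map Y]compose_idr -fg [compose (coalg_map Y) _]composeA coalg_funP.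
  by rewrite !composeA -fmap_comp gf fmap_id compose_idl.
by exists (CoalgebraHom gP); split; apply: coalgebra_hom_ext.
Qed.

Section Comonadicity.
Variables (C D : category) (F : functor C D) (G : functor D C) (adj : adjunction F G).

(** This says that [h] is a coalgebra morphism from [comparison_ob adj x] to [(N, theta)], in a form
    that makes sense before [theta] satisfies the coalgebra laws. *)
Definition comparison_equation (x : C) (N : D) (theta : hom N (F (G N)))
    (h : hom (F x) N) : Prop :=
  compose theta h = compose (fmap F (fmap G h)) (fmap F (adj_unit adj x)).

Definition counital (N : D) (theta : hom N (F (G N))) : Prop :=
  compose (adj_counit adj N) theta = idm N.

Definition coassociative (N : D) (theta : hom N (F (G N))) : Prop :=
  compose (fmap F (adj_unit adj (G N))) theta = compose (fmap F (fmap G theta)) theta.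

Lemma comonadic_faithful : comonadic adj -> faithful F.
Proof.
move=> /equivalence_faithful Kf x y f g fg.
by apply: Kf; apply: coalgebra_hom_ext.
Qed.

Lemma comonadic_full (x y : C) (h : hom (F x) (F y)) :
  comonadic adj -> comparison_equation (fmap F (adj_unit adj y)) h ->
  exists f : hom x y, fmap F f = h.
Proof.
move=> /equivalence_full Kf hP.
have [f fE] := Kf x y (@CoalgebraHom D (adjunction_comonad adj)
  (comparison_ob adj x) (comparison_ob adj y) h hP).
by exists f; exact: (congr1 (fun g => coalg_fun g) fE).
Qed.

(** Reduces comonadicity to assertions about morphisms of [D], free of coalgebra records. *)
Lemma comonadicity : faithful F ->
  (forall (x y : C) (h : hom (F x) (F y)),
    comparison_equation (fmap F (adj_unit adj y)) h -> exists f : hom x y, fmap F f = h) ->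
  (forall (N : D) (theta : hom N (F (G N))),
    counital theta -> coassociative theta ->
    exists (x : C) (g : hom (F x) N), is_iso g /\ comparison_equation theta g) ->
  comonadic adj.
Proof.
move=> Ff Fu Fe; apply: fully_faithful_equivalence.
- by move=> x y f g /(congr1 (fun h => coalg_fun h)); apply: Ff.
- move=> x y h; have [f fh] := Fu x y (coalg_fun h) (coalg_funP h).
  by exists f; apply: coalgebra_hom_ext.
- move=> [N theta theta1 theta2]; have [x [g [gI gP]]] := Fe N theta theta1 theta2.
  exists x, (@CoalgebraHom D (adjunction_comonad adj) (comparison_ob adj x)
    (Coalgebra theta1 theta2) g gP).
  exact: coalgebra_iso.
Qed.
End Comonadicity.

(** * Factorization through isometries *)

Section IsometricFactorization.
Context (R : realType) (k : scalar_kind) (A : banach_algebra (scalars R k)).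

Lemma isometry_inj (V W : banach_module A) (m : module_hom V W) :
  (forall v, nrm (m v) = nrm v) -> injective m.
Proof.
move=> mI x y mxy; apply/eqP; rewrite -subr_eq0; apply/eqP/(@nrm_eq0 R k).
by rewrite -mI (linB (mh_linear m)) mxy subrr nrm0.
Qed.

(** Preimages under the isometry [m] are unique, so a pointwise choice of them is linear,
    equivariant and contractive. *)
Lemma isometry_factor (U V W : banach_module A) (m : module_hom V W) (f : module_hom U W) :
  (forall v, nrm (m v) = nrm v) -> (forall u, exists v, m v = f u) ->
  exists r : module_hom U V, forall u, m (r u) = f u.
Proof.
move=> mI /choice[r rE]; have m_inj := isometry_inj mI.
have rL : linear r by move=> a x y; apply: m_inj; rewrite mh_linear !rE mh_linear.
have rA a x : r (act a x) = act a (r x) by apply: m_inj; rewrite mh_act !rE mh_act.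
have rC x : `|r x| <= `|x| by rewrite -ler_nrm -mI rE nrm_mh.
by exists (ModuleHom rL rA rC).
Qed.

Lemma isometry_iso (V W : banach_module A) (m : module_hom V W) :
  (forall v, nrm (m v) = nrm v) -> (forall w, exists v, m v = w) ->
  is_iso (C := module_category A) m.
Proof.
move=> mI ms; have [r rE] := isometry_factor (f := module_id W) mI ms.
exists r; split; apply: module_hom_ext => x; last exact: rE.
by apply: (isometry_inj mI); rewrite /= rE.
Qed.
End IsometricFactorization.

(* Without this, conversion compares extended modules by unfolding them. *)
Opaque extend_hom extension_counit ext_tens.

(** * The implications between descent, purity and weak retracts *)

Section Equivalences.
Context (R : realType) (k : scalar_kind).
Local Notation K := (scalars R k).
Variables (A : com_banach_algebra K) (B : banach_algebra K).
Variable i : banach_algebra_hom A B.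
Local Notation GF V := (restrict i (extend i V)).

Lemma ext_tens_act (V : banach_module A) b (v : V) :
  ext_tens i b v = @act K B (extend i V) b (extension_unit i V v).
Proof. by rewrite /= ext_actE bmulb1. Qed.

Lemma module_compE (C : banach_algebra K) (U V W : banach_module C)
  (g : module_hom V W) (f : module_hom U V) u : module_comp g f u = g (f u).
Proof. by []. Qed.

Lemma restrict_homE (M N : banach_module B) (f : module_hom M N) m :
  restrict_hom i f m = f m.
Proof. by []. Qed.

Lemma extension_unitE (V : banach_module A) v :
  extension_unit i V v = ext_tens i (bone B) v.
Proof. by []. Qed.

Lemma transpose_exists (W : banach_module A) (N : banach_module B)
    (e : module_hom W (restrict i N)) :
  exists g : module_hom (extend i W) N, forall b w, g (ext_tens i b w) = act b (e w : N).
Proof.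
exists (module_comp (extension_counit i N) (extend_hom i e)) => b w.
rewrite module_compE extend_homE; exact: (extension_counitE i b (e w)).
Qed.

Lemma extension_unit_equalizes (V : banach_module A) v :
  extend_hom i (extension_unit i V) (extension_unit i V v) =
  extension_unit i (GF V) (extension_unit i V v).
Proof. by rewrite !extension_unitE extend_homE. Qed.

(** The coalgebra morphism condition for [h], tested on elementary tensors. *)
Definition descent_compatible (V : banach_module A) (N : banach_module B)
    (theta : module_hom N (extend i (restrict i N))) (h : module_hom (extend i V) N) : Prop :=
  forall b v, theta (h (ext_tens i b v)) = ext_tens i b (h (extension_unit i V v) : restrict i N).

Lemma descent_compatibleP (V : banach_module A) (N : banach_module B)
    (theta : module_hom N (extend i (restrict i N))) (h : module_hom (extend i V) N) :
  descent_compatible theta h <->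
  comparison_equation (extension_adjunction i) (x := V) (N := N) theta h.
Proof.
(* Both sides are convertible; the module form is the one that the evaluation lemmas match. *)
have -> : comparison_equation (extension_adjunction i) (x := V) (N := N) theta h =
  (module_comp theta h =
    module_comp (extend_hom i (restrict_hom i h)) (extend_hom i (extension_unit i V))) by [].
have E b v : module_comp (extend_hom i (restrict_hom i h)) (extend_hom i (extension_unit i V))
    (ext_tens i b v) = ext_tens i b (h (extension_unit i V v) : restrict i N).
  rewrite module_compE (@extend_homE _ _ _ _ i V (GF V) (extension_unit i V) b v).
  by rewrite (@extend_homE _ _ _ _ i (GF V) (restrict i N) (restrict_hom i h) b _).
split=> [hP|hP b v]; last by rewrite -E -hP.
by apply: extend_hom_eq => b v; rewrite E -hP.
Qed.

Lemma effective_descent_faithful (V W : banach_module A) (f g : module_hom V W) :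
  effective_descent i -> extend_hom i f = extend_hom i g -> f = g.
Proof. by move=> /comonadic_faithful; apply. Qed.

Lemma effective_descent_full (V W : banach_module A) (h : module_hom (extend i V) (extend i W)) :
  effective_descent i -> descent_compatible (extend_hom i (extension_unit i W)) h ->
  exists f : module_hom V W, extend_hom i f = h.
Proof. by move=> desc /descent_compatibleP hP; exact: (comonadic_full desc hP). Qed.

Lemma effective_descent_criterion :
  (forall (V W : banach_module A) (f g : module_hom V W),
    extend_hom i f = extend_hom i g -> f = g) ->
  (forall (V W : banach_module A) (h : module_hom (extend i V) (extend i W)),
    descent_compatible (extend_hom i (extension_unit i W)) h ->
    exists f : module_hom V W, extend_hom i f = h) ->
  (forall (N : banach_module B) (theta : module_hom N (extend i (restrict i N))),
    module_comp (extension_counit i N) theta = module_id N ->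
    module_comp (extend_hom i (extension_unit i (restrict i N))) theta =
      module_comp (extend_hom i (restrict_hom i theta)) theta ->
    exists (V : banach_module A) (g : module_hom (extend i V) N),
      is_iso (C := module_category B) g /\ descent_compatible theta g) ->
  effective_descent i.
Proof.
move=> Ff Fu Fe; apply: comonadicity.
- exact: Ff.
- move=> V W h hP.
  have := descent_compatibleP (extend_hom i (extension_unit i W)) h; case=> _ /(_ hP).
  exact: Fu.
- move=> N theta t1 t2.
  have t2E : coassociative (extension_adjunction i) (N := N) theta =
    (module_comp (extend_hom i (extension_unit i (restrict i N))) theta =
      module_comp (extend_hom i (restrict_hom i theta)) theta) by [].
  have t1E : counital (extension_adjunction i) (N := N) theta =
    (module_comp (extension_counit i N) theta = module_id N) by [].
  rewrite t1E in t1; rewrite t2E in t2.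
  have [V [g [gI /descent_compatibleP gP]]] := Fe N theta t1 t2.
  by exists V; exists g; split; [exact: gI|exact: gP].
Qed.

(** The unit factors as [e] after [j] through the equalizer. Fullness descends the transpose of [e]
    to a map [r], faithfulness gives [r j = id], and the contraction [r] forces [j], hence the unit,
    to be isometric. *)
Lemma effective_descent_pure : effective_descent i -> tensor_pure i.
Proof.
move=> desc V; split; first exact: mh_linear.
pose th := restrict_hom i (extend_hom i (extension_unit i V)).
pose et := extension_unit i (GF V).
have [|j jE] := @isometry_factor R k A V (equalizer th et) (GF V) (equalizer_incl th et)
    (extension_unit i V) (@nrm_equalizer_incl _ _ _ _ _ th et).
  by move=> v; apply: equalizer_incl_surj; exact: extension_unit_equalizes.
have eI := @nrm_equalizer_incl _ _ _ _ _ th et.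
have eE w := @equalizer_inclE _ _ _ _ _ th et w.
(* From here on the equalizer is known only through [jE], [eI] and [eE]. *)
move: (equalizer th et) (equalizer_incl th et) j jE eI eE => W e j jE eI eE.
have {}eE w : extend_hom i (extension_unit i V) (e w) = ext_tens i (bone B) (e w).
  exact: eE.
have [g gE] := @transpose_exists W (extend i V) e.
have [|r rg] := @effective_descent_full W V g desc.
  move=> b w; rewrite gE mh_act eE extension_unitE gE act1.
  by rewrite [RHS](ext_tens_act b (e w)) extension_unitE.
have rE w : extension_unit i V (r w) = e w.
  by have := gE (bone B) w; rewrite -rg extend_homE act1.
have rj : module_comp r j = module_id V.
  apply: (effective_descent_faithful desc); apply: extend_hom_eq => b v.
  rewrite (@extend_homE _ _ _ _ i V V (module_comp r j) b v).
  rewrite (@extend_homE _ _ _ _ i V V (module_id V) b v).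
  by rewrite ext_tens_act module_compE rE jE -ext_tens_act.
move=> v; rewrite -!toK_nrm; congr toK; apply/eqP; rewrite eq_le nrm_mh andTb.
rewrite -jE eI.
by have := nrm_mh r (j v); rewrite -[r (j v)]/(module_comp r j v) rj.
Qed.

Hypothesis i_central : central_hom i.

Lemma weak_retract_pure : weak_retract (algebra_map i) -> tensor_pure i.
Proof.
move=> [s sK] V; split; first exact: mh_linear.
have {}sK f : dual_map (algebra_map i) (s f) = f.
  exact: (congr1 (fun g : module_hom _ _ => g f) sK).
move=> v; rewrite -!toK_nrm; congr toK.
exact: (extension_unit_isometric i_central sK).
Qed.

Lemma pure_weak_retract : tensor_pure i -> weak_retract (algebra_map i).
Proof.
move=> pure; pose A' := dual_module (regular_module A).
pose ev (f : A') : scalar_space R k := ihom_fun f (bone A).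
have evL : linear ev by move=> a f g; rewrite /ev dual_module_lin.
have [|h [hL hC hE]] := @hahn_banach R k A' (GF A')
    (norm_seminorm (GF A')) (extension_unit i A') ev (mh_linear (extension_unit i A')) evL.
  move=> f; have [_ uI] := pure A'; rewrite /= /nrm uI -/(nrm f).
  rewrite (le_trans (nrm_ihom f _))//; apply: ler_piMr; first exact: nrm_ge0.
  by rewrite -(ler_toK k) toK_nrm toK1 bone_norm.
have [el er] := ext_tens_bilinear i A'.
have sL0 (f : A') : linear (fun b : B => h (ext_tens i b f)).
  by move=> a b c; rewrite el hL.
have sC0 (f : A') (b : B) : nrm (h (ext_tens i b f)) <= nrm f * nrm b.
  by rewrite (le_trans (hC _))//= mulrC nrm_ext_tens.
pose s (f : A') : dual_module (restrict i (regular_module B)) :=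
  mk_ihom (sL0 f) (sC0 f) : dual_space (restrict i (regular_module B)).
have sE f b : ihom_fun (s f) b = h (ext_tens i b f) by exact: mk_ihomE.
have sL : linear s.
  by move=> a f g; apply: ihom_ext => b; rewrite dual_module_lin !sE er hL.
(* The scalar [a] crosses the tensor to become [i a] on the right of [b], and centrality moves it to
   the left. *)
have sA a f : s (act a f) = act a (s f).
  by apply: ihom_ext => b; rewrite dual_module_actE !sE -ext_tens_balanced -i_central.
have sC f : `|s f| <= `|f|.
  by rewrite -ler_nrm; apply: ihom_norm_le; [exact: nrm_ge0|exact: sC0].
exists (ModuleHom sL sA sC); apply: module_hom_ext => f; apply: ihom_ext => a.
rewrite [LHS](dual_mapE (algebra_map i) (s f)) sE /=.
(* Writing [i a] as [1 ** i a] moves [a] onto [f]; then [h] evaluates the functional [act a f] at 1,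
   which is the value of [f] at [a]. *)
rewrite -[i a]bmul1b ext_tens_balanced -[ext_tens _ _ _]/(extension_unit i A' _) hE.
by rewrite /ev dual_module_actE /= bmulb1.
Qed.

Lemma weak_retract_effective_descent :
  weak_retract (algebra_map i) -> effective_descent i.
Proof.
move=> [s sK].
have {}sK f : dual_map (algebra_map i) (s f) = f.
  exact: (congr1 (fun g : module_hom _ _ => g f) sK).
have uI V := extension_unit_isometric i_central sK (V := V).
apply: effective_descent_criterion.
- move=> V W f g fg; apply: module_hom_ext => v; apply: (isometry_inj (@uI W)).
  by rewrite !extension_unitE -!extend_homE fg.
- move=> V W h hP.
  have [|r rE] := @isometry_factor R k A V W (GF W) (extension_unit i W)
      (module_comp (restrict_hom i h) (extension_unit i V)) (@uI W).
    (* Compatibility at [b = 1] is the equation required of [h (extension_unit i V v)]. *)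
    by move=> v; apply: (extension_unit_exact i_central sK); exact: hP.
  exists r; apply: extend_hom_eq => b v.
  by rewrite extend_homE ext_tens_act rE module_compE restrict_homE -mh_act -ext_tens_act.
- move=> N theta theta1 theta2.
  have t1 n : extension_counit i N (theta n) = n.
    by rewrite -[LHS]module_compE theta1.
  have t2 n : extend_hom i (extension_unit i (restrict i N)) (theta n) =
      extend_hom i (restrict_hom i theta) (theta n).
    by rewrite -[LHS]module_compE theta2.
  pose V := equalizer (restrict_hom i theta) (extension_unit i (restrict i N)).
  exists V, (descent_map theta); split.
    apply: isometry_iso; first exact: (descent_map_isometric i_central sK t2).
    exact: (descent_map_surj i_central sK t1 t2).
  move=> b v; rewrite descent_mapE extend_homE; congr (ext_tens i b).
  rewrite [descent_map _ _]module_compE extension_unitE extend_homE.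
  by rewrite [RHS](@extension_counitE _ _ _ _ i N (bone B) _) act1.
Qed.
End Equivalences.

Theorem theorem3p1 (R : realType) (k : scalar_kind)
    (A : com_banach_algebra (scalars R k)) (B : banach_algebra (scalars R k))
    (i : banach_algebra_hom A B) (i_central : central_hom i) :
  (effective_descent i <-> tensor_pure i) /\
  (tensor_pure i <-> weak_retract (algebra_map i)).
Proof.
have pr := pure_weak_retract i_central; have rp := weak_retract_pure i_central.
split; split=> //; first exact: effective_descent_pure.
by move=> /pr; apply: weak_retract_effective_descent.
Qed.
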